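(* Let $\boldsymbol U=(p^{\mathrm{sc}},\boldsymbol u)\in\mathscr H^1_{\mathrm{qp}}(\Omega)$ be the solution of $A(\boldsymbol U,\boldsymbol V)=L(\boldsymbol V)$ for all $\boldsymbol V\in\mathscr H^1_{\mathrm{qp}}(\Omega)$, and let $\widetilde F=\max\{F_1,F_2\}$. If $\widetilde F\gamma_1^2<\gamma_0$, then the problem of finding $\boldsymbol U^{\mathrm{PML}}=(p^{\mathrm{sc},\mathrm{PML}},\boldsymbol u^{\mathrm{PML}})\in\mathscr H^1_{\mathrm{qp}}(\Omega)$ such that $$A^{\mathrm{PML}}(\boldsymbol U^{\mathrm{PML}},\boldsymbol V)=L(\boldsymbol V)\qquad\text{for all }\boldsymbol V\in\mathscr H^1_{\mathrm{qp}}(\Omega)$$ has a unique solution, and this solution satisfies $$\sup_{0\ne\boldsymbol V\in\mathscr H^1_{\mathrm{qp}}(\Omega)}\frac{|A(\boldsymbol U-\boldsymbol U^{\mathrm{PML}},\boldsymbol V)|}{\|\boldsymbol V\|_{\mathscr H^1_{\mathrm{qp}}(\Omega)}}\le F_1\gamma_1\|p^{\mathrm{sc},\mathrm{PML}}\|_{L^2(\Gamma_+)}+F_2\gamma_1\|\boldsymbol u^{\mathrm{PML}}\|_{L^2(\Gamma_-)^2}.$$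
   Context: Geometry. $f$ is a $\Lambda$-periodic Lipschitz function, $\Lambda>0$; $h_2<f<h_1$ with constants $h_1,h_2$; $\Gamma=\{0<x_1<\Lambda,\ x_2=f(x_1)\}$; $\Omega_+=\{0<x_1<\Lambda,\ f(x_1)<x_2<h_1\}$; $\Omega_-=\{0<x_1<\Lambda,\ h_2<x_2<f(x_1)\}$; $\Omega=\Omega_+\cup\Omega_-$; $\Gamma_+=\{0<x_1<\Lambda,\ x_2=h_1\}$; $\Gamma_-=\{0<x_1<\Lambda,\ x_2=h_2\}$; $\boldsymbol n$ is the unit normal on $\Gamma$ pointing into the region $x_2>f(x_1)$. PML layers with thicknesses $\delta_1,\delta_2>0$: $\Omega_+^{\mathrm{PML}}=\{0<x_1<\Lambda,\ h_1<x_2<h_1+\delta_1\}$, $\Omega_-^{\mathrm{PML}}=\{0<x_1<\Lambda,\ h_2-\delta_2<x_2<h_2\}$, with outer boundaries $\Gamma_+^{\mathrm{PML}}=\{0<x_1<\Lambda,\ x_2=h_1+\delta_1\}$, $\Gamma_-^{\mathrm{PML}}=\{0<x_1<\Lambda,\ x_2=h_2-\delta_2\}$. Parameters. $\rho_f,\rho,\omega,\kappa>0$; Lamé constants $\mu>0$, $\lambda+\mu>0$; $\theta\in(-\pi/2,\pi/2)$, $\alpha=\kappa\sin\theta$, $\beta=\kappa\cos\theta$, $p^{\mathrm{in}}=e^{\mathrm i(\alpha x_1-\beta x_2)}$; $\alpha_n=\alpha+2\pi n/\Lambda$ $(n\in\mathbb Z)$; $\kappa_1=\omega\sqrt{\rho/(2\mu+\lambda)}$,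 $\kappa_2=\omega\sqrt{\rho/\mu}$; $\beta_n=(\kappa^2-\alpha_n^2)^{1/2}$ if $|\alpha_n|<\kappa$ and $\beta_n=\mathrm i(\alpha_n^2-\kappa^2)^{1/2}$ if $|\alpha_n|>\kappa$; $\beta_n^{(j)}$ is defined likewise with $\kappa_j$ in place of $\kappa$. Standing assumptions: $|\alpha_n|\ne\kappa,\kappa_1,\kappa_2$ for all $n$, and $\omega$ is not a Jones frequency. Spaces. A function $v$ is quasi-periodic if $v(\Lambda,x_2)=e^{\mathrm i\alpha\Lambda}v(0,x_2)$; $H^1_{\mathrm{qp}}(\cdot)$ is the subspace of quasi-periodic functions in $H^1(\cdot)$. $\mathscr H^1_{\mathrm{qp}}(\Omega)=H^1_{\mathrm{qp}}(\Omega_+)\times H^1_{\mathrm{qp}}(\Omega_-)^2$, with, for $\boldsymbol V=(\varphi,\boldsymbol\psi)$, $\|\boldsymbol V\|^2_{\mathscr H^1_{\mathrm{qp}}(\Omega)}=\int_{\Omega_+}(|\nabla\varphi|^2+|\varphi|^2)\,d\boldsymbol x+\int_{\Omega_-}(\mathcal E_{\lambda,\mu}(\boldsymbol\psi,\boldsymbol\psi)+|\boldsymbol\psi|^2)\,d\boldsymbol x$, where $\mathcal E_{\lambda,\mu}(\boldsymbol u,\boldsymbol\psi)=\lambda(\nabla\cdot\boldsymbol u)(\nabla\cdot\overline{\boldsymbol\psi})+\frac\mu2(\nabla\boldsymbol u+\nabla\boldsymbol u^\top):(\nabla\overline{\boldsymbol\psi}+\nabla\overline{\boldsymbol\psi}^\top)$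 (equivalent to the standard $H^1$-norm by Korn's inequality). Write $v_n(x_2)=\frac1\Lambda\int_0^\Lambda v(x_1,x_2)e^{-\mathrm i\alpha_nx_1}dx_1$. $\|p\|^2_{H^{1/2}(\Gamma_\pm)}=\Lambda\sum_n(1+\alpha_n^2)^{1/2}|p_n|^2$ with $p_n$ evaluated on $\Gamma_\pm$. Exact boundary operators. $\mathscr T_+p=\sum_n\mathrm i\beta_np_n(h_1)e^{\mathrm i\alpha_nx_1}$ on $\Gamma_+$; $\mathscr T_-\boldsymbol u=\sum_nW_n\boldsymbol u_n(h_2)e^{\mathrm i\alpha_nx_1}$ on $\Gamma_-$ with $\mathcal X_n=\alpha_n^2+\beta_n^{(1)}\beta_n^{(2)}$ and $$W_n=\frac{\mathrm i}{\mathcal X_n}\begin{bmatrix}\omega^2\rho\beta_n^{(1)}&-2\mu\alpha_n\mathcal X_n+\omega^2\rho\alpha_n\\2\mu\alpha_n\mathcal X_n-\omega^2\rho\alpha_n&\omega^2\rho\beta_n^{(2)}\end{bmatrix}.$$ PML. $s=1$ for $h_2<x_2<h_1$, $s(x_2)=1+\sigma_1\big(\frac{x_2-h_1}{\delta_1}\big)^t$ for $x_2\ge h_1$, $s(x_2)=1+\sigma_2\big(\frac{h_2-x_2}{\delta_2}\big)^t$ for $x_2\le h_2$, with $t\ge1$ and complex $\sigma_j$ such that $\Re s\ge1$ everywhere and $\Im s>0$ inside the layers. $\eta_1=\int_{h_1}^{h_1+\delta_1}s\,d\tau$, $\eta_2=\int_{h_2-\delta_2}^{h_2}s\,d\tau$.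 $\nabla_{\hat{\boldsymbol x}}=[\partial_{x_1},s^{-1}\partial_{x_2}]^\top$, $\Delta_{\hat{\boldsymbol x}}=\nabla_{\hat{\boldsymbol x}}\cdot\nabla_{\hat{\boldsymbol x}}$, $\Delta^*_{\hat{\boldsymbol x}}=\mu\Delta_{\hat{\boldsymbol x}}+(\lambda+\mu)\nabla_{\hat{\boldsymbol x}}\nabla_{\hat{\boldsymbol x}}\cdot$. On $\Gamma_-$, $\mathscr B\boldsymbol u=\big[-\mu(\partial_{x_2}u_1+\partial_{x_1}u_2),\ -(2\mu+\lambda)\partial_{x_2}u_2-\lambda\partial_{x_1}u_1\big]^\top$. PML boundary operators. $\mathscr T_+^{\mathrm{PML}}p=\sum_n\mathrm i\beta_n\coth(-\mathrm i\beta_n\eta_1)p_n(h_1)e^{\mathrm i\alpha_nx_1}$ on $\Gamma_+$. $\mathscr T_-^{\mathrm{PML}}\boldsymbol u=\mathscr B\hat{\boldsymbol w}|_{\Gamma_-}$, where $\hat{\boldsymbol w}$ is the quasi-periodic solution (quasi-periodically extended across the lateral sides) of $\Delta^*_{\hat{\boldsymbol x}}\hat{\boldsymbol w}+\omega^2\rho\hat{\boldsymbol w}=0$ in $\Omega_-^{\mathrm{PML}}$, $\hat{\boldsymbol w}=\boldsymbol u$ on $\Gamma_-$, $\hat{\boldsymbol w}=0$ on $\Gamma_-^{\mathrm{PML}}$ (unique solvability of this layer problem is understood). Forms (boundary integrals understood as duality pairings). For $\boldsymbol U=(p,\boldsymbol u)$, $\boldsymbol V=(\varphi,\boldsymbol\psi)$: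 $$A(\boldsymbol U,\boldsymbol V)=\int_{\Omega_+}(\nabla p\cdot\nabla\overline\varphi-\kappa^2p\overline\varphi)d\boldsymbol x+\int_{\Omega_-}(\mathcal E_{\lambda,\mu}(\boldsymbol u,\boldsymbol\psi)-\omega^2\rho\,\boldsymbol u\cdot\overline{\boldsymbol\psi})d\boldsymbol x+\int_\Gamma p\,\boldsymbol n\cdot\overline{\boldsymbol\psi}\,ds+\int_\Gamma\rho_f\omega^2\boldsymbol u\cdot\boldsymbol n\,\overline\varphi\,ds-\int_{\Gamma_+}\mathscr T_+p\,\overline\varphi\,ds-\int_{\Gamma_-}\mathscr T_-\boldsymbol u\cdot\overline{\boldsymbol\psi}\,ds,$$ $A^{\mathrm{PML}}$ is the same form with $\mathscr T_\pm$ replaced by $\mathscr T_\pm^{\mathrm{PML}}$, and $L(\boldsymbol V)=\int_\Gamma(\partial_{\boldsymbol n}p^{\mathrm{in}}\,\overline\varphi-p^{\mathrm{in}}\boldsymbol n\cdot\overline{\boldsymbol\psi})ds$. Constants and facts taken as known. The problem with form $A$ is uniquely solvable, and $\gamma_0>0$ is a constant with $\sup_{0\ne\boldsymbol V}|A(\boldsymbol U,\boldsymbol V)|/\|\boldsymbol V\|_{\mathscr H^1_{\mathrm{qp}}(\Omega)}\ge\gamma_0\|\boldsymbol U\|_{\mathscr H^1_{\mathrm{qp}}(\Omega)}$ for all $\boldsymbol U\in\mathscr H^1_{\mathrm{qp}}(\Omega)$. $\gamma_1=(1+(h_1-h_2)^{-1})^{1/2}$ is the constant of the trace inequalities $\|\varphi\|_{L^2(\Gamma_+)}\le\|\varphi\|_{H^{1/2}(\Gamma_+)}\le\gamma_1\|\varphi\|_{H^1(\Omega_+)}$,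 $\|\boldsymbol\psi\|_{L^2(\Gamma_-)^2}\le\|\boldsymbol\psi\|_{H^{1/2}(\Gamma_-)^2}\le\gamma_1\|\boldsymbol\psi\|_{H^1(\Omega_-)^2}$ for $(\varphi,\boldsymbol\psi)\in\mathscr H^1_{\mathrm{qp}}(\Omega)$. With $I=\{n:|\alpha_n|<\kappa\}$, $I_j=\{n:|\alpha_n|<\kappa_j\}$, $\Theta_n=|\kappa^2-\alpha_n^2|^{1/2}$, $\Theta_n^{(j)}=|\kappa_j^2-\alpha_n^2|^{1/2}$, $\Theta^i=\min_{n\in I}\Theta_n$, $\Theta^e=\min_{n\notin I}\Theta_n$, $\Theta_j^i=\min_{n\in I_j}\Theta_n^{(j)}$, $\Theta_j^e=\min_{n\notin I_j}\Theta_n^{(j)}$ (terms indexed by an empty set are omitted), $$F_1=\max\Big\{\frac{2\Theta^i}{e^{2\Im\eta_1\Theta^i}-1},\frac{2\Theta^e}{e^{2\Re\eta_1\Theta^e}-1}\Big\},$$ $$F_2=\frac{34\omega^2\rho}{\kappa_1^4}\max_{j=1,2}\Big\{\frac{\Theta_j^i}{e^{\frac12\Theta_j^i\Im\eta_2}-1},\frac{\Theta_j^e}{e^{\frac12\Theta_j^e\Re\eta_2}-1}\Big\}\max\Big\{6\kappa_2,\kappa_2^2+4,8\kappa_2^4,\frac{8\kappa_2^3}{\kappa_1^2},\frac{12(\kappa_2^2+16)^2}{\kappa_1^2}\Big\};$$ these are the constants in the known estimates $|\langle(\mathscr T_+^{\mathrm{PML}}-\mathscr T_+)p,\varphi\rangle_{\Gamma_+}|\le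 F_1\|p\|_{L^2(\Gamma_+)}\|\varphi\|_{L^2(\Gamma_+)}$ and $|\langle(\mathscr T_-^{\mathrm{PML}}-\mathscr T_-)\boldsymbol u,\boldsymbol\psi\rangle_{\Gamma_-}|\le F_2\|\boldsymbol u\|_{L^2(\Gamma_-)^2}\|\boldsymbol\psi\|_{L^2(\Gamma_-)^2}$ for $(p,\boldsymbol u),(\varphi,\boldsymbol\psi)\in\mathscr H^1_{\mathrm{qp}}(\Omega)$. *)

(* Defs.v *)
From HB Require Import structures.
From mathcomp Require Import all_boot all_order all_algebra.
From mathcomp Require Import all_classical all_reals all_analysis.
From mathcomp Require Import complex.

Set Implicit Arguments.
Unset Strict Implicit.
Unset Printing Implicit Defensive.

Import Order.TTheory GRing.Theory Num.Theory.
Import numFieldNormedType.Exports.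

Local Open Scope classical_set_scope.
Local Open Scope ring_scope.

Definition leb1 (R : realType) := @lebesgue_measure R.
Definition leb2 (R : realType) := (@lebesgue_measure R \x @lebesgue_measure R)%E.
Arguments leb1 : clear implicits.
Arguments leb2 : clear implicits.

Definition cabs (R : realType) (z : R[i]) : R := ComplexField.Normc.normc z.

Definition iC (R : realType) : R[i] := (0 +i* 1)%C.

Definition cexp (R : realType) (z : R[i]) : R[i] :=
  (expR (complex.Re z))%:C%C *
  (cos (complex.Im z) +i* sin (complex.Im z))%C.

Definition ccoth (R : realType) (z : R[i]) : R[i] :=
  (cexp z + cexp (- z)) / (cexp z - cexp (- z)).

Definition cint d (T : measurableType d) (R : realType)
    (mu : {measure set T -> \bar R}) (D : set T) (g : T -> R[i]) : R[i] :=
  (Rintegral mu D (fun x => complex.Re (g x)) +i*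
   Rintegral mu D (fun x => complex.Im (g x)))%C.

(* Two-sided series, as the limit of the symmetric partial sums. *)
Definition csumZ (R : realType) (a : int -> R[i]) : R[i] :=
  let S (N : nat) := \sum_(k < N.*2.+1) a (k%:Z - N%:Z) in
  (limn (fun N => complex.Re (S N)) +i* limn (fun N => complex.Im (S N)))%C.

Definition L2 d (T : measurableType d) (R : realType)
    (mu : {measure set T -> \bar R}) (D : set T) (g : T -> R[i]) : Prop :=
  [/\ measurable_fun D (fun x => complex.Re (g x)),
      measurable_fun D (fun x => complex.Im (g x)) &
      (\int[mu]_(x in D) ((cabs (g x) ^+ 2)%:E) < +oo)%E].

Definition basis2 (R : realType) (i : 'I_2) : R * R :=
  if i == ord0 then (1, 0) else (0, 1).

Fixpoint Ck (R : realType) (k : nat) (g : R * R -> R) : Prop :=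
  continuous g /\
  match k with
  | 0%N => True
  | k'.+1 => forall i : 'I_2,
      (forall x, derivable g x (basis2 R i)) /\
      Ck k' (fun x => 'D_(basis2 R i) g x)
  end.

Definition smooth (R : realType) (g : R * R -> R) : Prop := forall k, Ck k g.

Definition csmooth (R : realType) (g : R * R -> R[i]) : Prop :=
  smooth (fun x => complex.Re (g x)) /\ smooth (fun x => complex.Im (g x)).

Definition cpartial (R : realType) (i : 'I_2) (g : R * R -> R[i]) (x : R * R)
    : R[i] :=
  ('D_(basis2 R i) (fun y => complex.Re (g y)) x +i*
   'D_(basis2 R i) (fun y => complex.Im (g y)) x)%C.

Definition test_fun (R : realType) (D : set (R * R)) (phi : R * R -> R) : Prop :=
  smooth phi /\
  exists K : set (R * R),
    [/\ compact K, K `<=` D & forall x, ~ K x -> phi x = 0].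

(* All data of the problem; [height1], [height2] are the constants h_1, h_2
   and [expo] is the exponent t of the PML profile. *)
Record setting (R : realType) := Setting {
  Lam : R;
  surf : R -> R;
  height1 : R;
  height2 : R;
  delta1 : R;
  delta2 : R;
  rhof : R;
  rho : R;
  omega : R;
  kappa : R;
  lam : R;
  mu : R;
  theta : R;
  expo : R;
  sigma1 : R[i];
  sigma2 : R[i]
}.

(* Candidate elements of H^1 of a strip {0 < x_1 < Lam, a(x_1) < x_2 < b(x_1)}.
   A function is stored with its weak gradient and with its traces on the lower
   and upper boundary curves (parametrised by x_1).  The predicate [H1qp] below
   ties these components to the function: the strips are Lipschitz domains, so
   each function of H^1 has them and determines them up to null sets.  The
   [R[i]^o] makes the type a vector space over R[i]. *)
Definition sob (R : realType) : Type :=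
  ((R * R -> R[i]^o) * ('I_2 -> R * R -> R[i]^o) *
   (R -> R[i]^o) * (R -> R[i]^o))%type.

Definition vsob (R : realType) : Type := ('I_2 -> sob R)%type.

Definition hsob (R : realType) : Type := (sob R * vsob R)%type.

HB.instance Definition _ (R : realType) := GRing.Lmodule.on (sob R).
HB.instance Definition _ (R : realType) := GRing.Lmodule.on (vsob R).
HB.instance Definition _ (R : realType) := GRing.Lmodule.on (hsob R).

Definition fn (R : realType) (v : sob R) : R * R -> R[i] := v.1.1.1.
Definition pd (R : realType) (v : sob R) (i : 'I_2) : R * R -> R[i] := v.1.1.2 i.
Definition bot (R : realType) (v : sob R) : R -> R[i] := v.1.2.
Definition top (R : realType) (v : sob R) : R -> R[i] := v.2.

Definition alpha (R : realType) (P : setting R) : R := kappa P * sin (theta P).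
Definition beta (R : realType) (P : setting R) : R := kappa P * cos (theta P).

Definition strip (R : realType) (P : setting R) (a b : R -> R) : set (R * R) :=
  [set x | 0 < x.1 < Lam P /\ a x.1 < x.2 < b x.1].

Definition period (R : realType) (P : setting R) : set R :=
  [set x | 0 < x < Lam P].

(* [w] is the trace of [v] along the curve [c] parametrised by [J]: the trace
   operator is the continuous extension of the restriction of smooth functions,
   from H^1(D) to L^2 of the curve. *)
Definition is_trace (R : realType) (D : set (R * R)) (v : sob R)
    (c : R -> R * R) (J : set R) (w : R -> R[i]) : Prop :=
  L2 (leb1 R) J w /\
  exists Phi : nat -> R * R -> R[i],
    [/\ forall k, csmooth (Phi k),
        (\int[leb2 R]_(x in D) ((cabs (Phi k x - fn v x) ^+ 2)%:E))%E
          @[k --> \oo] --> 0%E,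
        forall i, (\int[leb2 R]_(x in D)
            ((cabs (cpartial i (Phi k) x - pd v i x) ^+ 2)%:E))%E
          @[k --> \oo] --> 0%E &
        (\int[leb1 R]_(y in J) ((cabs (Phi k (c y) - w y) ^+ 2)%:E))%E
          @[k --> \oo] --> 0%E].

Definition weak_partial (R : realType) (D : set (R * R)) (v g : R * R -> R[i])
    (i : 'I_2) : Prop :=
  forall phi, test_fun D phi ->
    cint (leb2 R) D (fun x => v x * ('D_(basis2 R i) phi x)%:C%C) =
    - cint (leb2 R) D (fun x => g x * (phi x)%:C%C).

Definition quasi_periodic (R : realType) (P : setting R) (a b : R -> R)
    (v : sob R) : Prop :=
  exists w : R -> R[i],
    is_trace (strip P a b) v (fun y => (0, y)) [set y | a 0 < y < b 0] w /\
    is_trace (strip P a b) v (fun y => (Lam P, y))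
      [set y | a (Lam P) < y < b (Lam P)]
      (fun y => cexp (0 +i* (alpha P * Lam P))%C * w y).

Definition H1qp (R : realType) (P : setting R) (a b : R -> R) (v : sob R)
    : Prop :=
  let D := strip P a b in
  [/\ L2 (leb2 R) D (fn v),
      forall i, L2 (leb2 R) D (pd v i) /\ weak_partial D (fn v) (pd v i) i,
      is_trace D v (fun x1 => (x1, a x1)) (period P) (bot v),
      is_trace D v (fun x1 => (x1, b x1)) (period P) (top v) &
      quasi_periodic P a b v].

Definition H1plus (R : realType) (P : setting R) (p : sob R) : Prop :=
  H1qp P (surf P) (cst (height1 P)) p.

Definition H1minus (R : realType) (P : setting R) (u : vsob R) : Prop :=
  forall i, H1qp P (cst (height2 P)) (surf P) (u i).

Definition H1layer (R : realType) (P : setting R) (w : vsob R) : Prop :=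
  forall i, H1qp P (cst (height2 P - delta2 P)) (cst (height2 P)) (w i).

Definition HH (R : realType) (P : setting R) (U : hsob R) : Prop :=
  H1plus P U.1 /\ H1minus P U.2.

Definition Oplus (R : realType) (P : setting R) :=
  strip P (surf P) (cst (height1 P)).
Definition Ominus (R : realType) (P : setting R) :=
  strip P (cst (height2 P)) (surf P).
Definition Olayer (R : realType) (P : setting R) :=
  strip P (cst (height2 P - delta2 P)) (cst (height2 P)).

Definition div2 (R : realType) (u : vsob R) (x : R * R) : R[i] :=
  \sum_(i < 2) pd (u i) i x.

Definition Elm (R : realType) (P : setting R) (u psi : vsob R) (x : R * R)
    : R[i] :=
  (lam P)%:C%C * div2 u x * (div2 psi x)^*%C +
  (mu P / 2)%:C%C * \sum_(i < 2) \sum_(j < 2)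
    (pd (u i) j x + pd (u j) i x) * ((pd (psi i) j x + pd (psi j) i x)^*)%C.

Definition normplus (R : realType) (P : setting R) (p : sob R) : R :=
  Num.sqrt (Rintegral (leb2 R) (Oplus P) (fun x =>
    \sum_(i < 2) cabs (pd p i x) ^+ 2 + cabs (fn p x) ^+ 2)).

(* The norm of H^1(Omega_-)^2 is the elastic-energy one. *)
Definition normminus (R : realType) (P : setting R) (u : vsob R) : R :=
  Num.sqrt (Rintegral (leb2 R) (Ominus P) (fun x =>
    complex.Re (Elm P u u x) + \sum_(i < 2) cabs (fn (u i) x) ^+ 2)).

Definition hnorm (R : realType) (P : setting R) (U : hsob R) : R :=
  Num.sqrt (normplus P U.1 ^+ 2 + normminus P U.2 ^+ 2).

Definition normlayer (R : realType) (P : setting R) (w : vsob R) : R :=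
  Num.sqrt (Rintegral (leb2 R) (Olayer P) (fun x => \sum_(i < 2)
    (\sum_(j < 2) cabs (pd (w i) j x) ^+ 2 + cabs (fn (w i) x) ^+ 2))).

Definition l2norm (R : realType) (P : setting R) (w : R -> R[i]) : R :=
  Num.sqrt (Rintegral (leb1 R) (period P) (fun x => cabs (w x) ^+ 2)).

Definition vl2norm (R : realType) (P : setting R) (w : 'I_2 -> R -> R[i]) : R :=
  Num.sqrt (\sum_(i < 2) l2norm P (w i) ^+ 2).

Definition kappa1 (R : realType) (P : setting R) : R :=
  omega P * Num.sqrt (rho P / (2 * mu P + lam P)).
Definition kappa2 (R : realType) (P : setting R) : R :=
  omega P * Num.sqrt (rho P / mu P).

Definition alphan (R : realType) (P : setting R) (n : int) : R :=
  alpha P + 2 * pi * n%:~R / Lam P.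

(* [betan P k n] is beta_n, beta_n^(1), beta_n^(2) for k = kappa, kappa_1,
   kappa_2; likewise for [Theta] and [prop_modes] (the index sets I, I_j). *)
Definition betan (R : realType) (P : setting R) (k : R) (n : int) : R[i] :=
  if `|alphan P n| < k then (Num.sqrt (k ^+ 2 - alphan P n ^+ 2))%:C%C
  else (0 +i* Num.sqrt (alphan P n ^+ 2 - k ^+ 2))%C.

Definition Theta (R : realType) (P : setting R) (k : R) (n : int) : R :=
  Num.sqrt `|k ^+ 2 - alphan P n ^+ 2|.

Definition prop_modes (R : realType) (P : setting R) (k : R) : set int :=
  [set n | `|alphan P n| < k].

Definition fcoef (R : realType) (P : setting R) (w : R -> R[i]) (n : int)
    : R[i] :=
  (Lam P)^-1%:C%C * cint (leb1 R) (period P) (fun x =>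
    w x * cexp (0 +i* (- (alphan P n * x)))%C).

Definition hhalf2 (R : realType) (P : setting R) (w : R -> R[i]) : \bar R :=
  ((Lam P)%:E * \esum_(n in [set: int])
    (Num.sqrt (1 + alphan P n ^+ 2) * cabs (fcoef P w n) ^+ 2)%:E)%E.

Definition hhalf (R : realType) (P : setting R) (w : R -> R[i]) : \bar R :=
  sqrte (hhalf2 P w).

Definition vhhalf (R : realType) (P : setting R) (w : 'I_2 -> R -> R[i])
    : \bar R :=
  sqrte (\sum_(i < 2) hhalf2 P (w i))%E.

(* H^{-1/2}-H^{1/2} duality on a horizontal line between the distribution with
   Fourier coefficients [g] and the trace [w]: the extension of the integral of
   (sum_n g_n e^{i alpha_n x_1}) times the conjugate of [w]. *)
Definition dual (R : realType) (P : setting R) (g : int -> R[i])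
    (w : R -> R[i]) : R[i] :=
  (Lam P)%:C%C * csumZ (fun n => g n * (fcoef P w n)^*%C).

Definition Tplus (R : realType) (P : setting R) (p : sob R) (n : int) : R[i] :=
  iC R * betan P (kappa P) n * fcoef P (top p) n.

Definition Tplus_pair (R : realType) (P : setting R) (p phi : sob R) : R[i] :=
  dual P (Tplus P p) (top phi).

Definition Xn (R : realType) (P : setting R) (n : int) : R[i] :=
  (alphan P n ^+ 2)%:C%C + betan P (kappa1 P) n * betan P (kappa2 P) n.

Definition Wn (R : realType) (P : setting R) (n : int) : 'M[R[i]]_2 :=
  let w2r := (omega P ^+ 2 * rho P)%:C%C in
  let an := (alphan P n)%:C%C in
  let mu2 := (2 * mu P)%:C%C in
  \matrix_(i < 2, j < 2) (iC R / Xn P n *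
    (if i == ord0 then
       if j == ord0 then w2r * betan P (kappa1 P) n
       else - (mu2 * an * Xn P n) + w2r * an
     else
       if j == ord0 then mu2 * an * Xn P n - w2r * an
       else w2r * betan P (kappa2 P) n)).

Definition Tminus (R : realType) (P : setting R) (u : vsob R) (i : 'I_2)
    (n : int) : R[i] :=
  \sum_(j < 2) Wn P n i j * fcoef P (bot (u j)) n.

Definition Tminus_pair (R : realType) (P : setting R) (u psi : vsob R) : R[i] :=
  \sum_(i < 2) dual P (Tminus P u i) (bot (psi i)).

Definition spml (R : realType) (P : setting R) (x2 : R) : R[i] :=
  if height1 P <= x2 then
    1 + sigma1 P * (((x2 - height1 P) / delta1 P) `^ expo P)%:C%C
  else if x2 <= height2 P then
    1 + sigma2 P * (((height2 P - x2) / delta2 P) `^ expo P)%:C%C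
  else 1.

Definition eta1 (R : realType) (P : setting R) : R[i] :=
  cint (leb1 R) [set y | height1 P < y < height1 P + delta1 P] (spml P).
Definition eta2 (R : realType) (P : setting R) : R[i] :=
  cint (leb1 R) [set y | height2 P - delta2 P < y < height2 P] (spml P).

Definition TplusPML (R : realType) (P : setting R) (p : sob R) (n : int)
    : R[i] :=
  iC R * betan P (kappa P) n *
  ccoth (- (iC R * betan P (kappa P) n * eta1 P)) * fcoef P (top p) n.

Definition TplusPML_pair (R : realType) (P : setting R) (p phi : sob R)
    : R[i] :=
  dual P (TplusPML P p) (top phi).

(* Stretched derivative in direction j: [g] is the value at x of the ordinary
   derivative in that direction. *)
Definition stretch (R : realType) (P : setting R) (x : R * R) (j : 'I_2)
    (g : R[i]) : R[i] :=
  if j == ord0 then g else g / spml P x.2.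

Definition stress_hat (R : realType) (P : setting R) (w : vsob R) (i j : 'I_2)
    (x : R * R) : R[i] :=
  (if i == j then
     (lam P)%:C%C * \sum_(k < 2) stretch P x k (pd (w k) k x)
   else 0) +
  (mu P)%:C%C * (stretch P x j (pd (w i) j x) + stretch P x i (pd (w j) i x)).

(* Weak form of  -s (Delta^*_hat w + omega^2 rho w).  Since s depends on x_2
   only, s Delta^*_hat w = d_1 (s stress_hat_{.1}) + d_2 stress_hat_{.2}. *)
Definition layer_form (R : realType) (P : setting R) (w Psi : vsob R) : R[i] :=
  cint (leb2 R) (Olayer P) (fun x => spml P x.2 *
    (\sum_(i < 2) \sum_(j < 2)
       stress_hat P w i j x * stretch P x j (pd (Psi i) j x)^*%C -
     (omega P ^+ 2 * rho P)%:C%C *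
       \sum_(i < 2) fn (w i) x * (fn (Psi i) x)^*%C)).

Definition layer_lift (R : realType) (P : setting R) (g : 'I_2 -> R -> R[i])
    (w : vsob R) : Prop :=
  H1layer P w /\
  forall i, {ae leb1 R, forall x, period P x -> top (w i) x = g i x} /\
            {ae leb1 R, forall x, period P x -> bot (w i) x = 0}.

(* Testing with quasi-periodic functions, not only with functions vanishing on
   the lateral sides, expresses that the equation holds for the quasi-periodic
   extension. *)
Definition layer_sol (R : realType) (P : setting R) (u w : vsob R) : Prop :=
  layer_lift P (fun i => bot (u i)) w /\
  forall Psi, layer_lift P (fun _ _ => 0) Psi -> layer_form P w Psi = 0.

Definition layer_uniquely_solvable (R : realType) (P : setting R) : Prop :=
  forall u, H1minus P u ->
    exists w, layer_sol P u w /\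
      forall w', layer_sol P u w' -> normlayer P (w' - w) = 0.

(* Pairing of T_-^PML u = B w with the trace of psi on Gamma_-, where w solves
   the layer problem with datum u.  The outward normal of the layer on Gamma_-
   is e_2 and s = 1 there, so B w = - stress_hat e_2, and Green's formula gives
   <B w, psi> = - layer_form w Psi for every Psi with trace psi on Gamma_- and
   trace 0 on the outer boundary. *)
Definition TminusPML_pair (R : realType) (P : setting R) (u psi : vsob R)
    : R[i] :=
  xget 0 [set z | exists w Psi,
    [/\ layer_sol P u w, layer_lift P (fun i => bot (psi i)) Psi &
        z = - layer_form P w Psi]].

Definition arc (R : realType) (P : setting R) (x1 : R) : R :=
  Num.sqrt (1 + derive1 (surf P) x1 ^+ 2).

Definition normal (R : realType) (P : setting R) (i : 'I_2) (x1 : R) : R :=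
  (if i == ord0 then - derive1 (surf P) x1 else 1) / arc P x1.

Definition int_Gamma (R : realType) (P : setting R) (g : R -> R[i]) : R[i] :=
  cint (leb1 R) (period P) (fun x1 => g x1 * (arc P x1)%:C%C).

Definition elastic_form (R : realType) (P : setting R) (u psi : vsob R)
    : R[i] :=
  cint (leb2 R) (Ominus P) (fun x => Elm P u psi x -
    (omega P ^+ 2 * rho P)%:C%C * \sum_(i < 2) fn (u i) x * (fn (psi i) x)^*%C).

Definition acoustic_form (R : realType) (P : setting R) (p phi : sob R)
    : R[i] :=
  cint (leb2 R) (Oplus P) (fun x =>
    \sum_(i < 2) pd p i x * (pd phi i x)^*%C -
    (kappa P ^+ 2)%:C%C * fn p x * (fn phi x)^*%C).

(* The form with the boundary operators left abstract.  On Gamma the acoustic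
   trace is [bot] and the elastic trace is [top]. *)
Definition Agen (R : realType) (P : setting R)
    (Tp : sob R -> sob R -> R[i]) (Tm : vsob R -> vsob R -> R[i])
    (U V : hsob R) : R[i] :=
  acoustic_form P U.1 V.1 + elastic_form P U.2 V.2 +
  int_Gamma P (fun x1 => bot U.1 x1 *
    \sum_(i < 2) (normal P i x1)%:C%C * (top (V.2 i) x1)^*%C) +
  int_Gamma P (fun x1 => (rhof P * omega P ^+ 2)%:C%C *
    (\sum_(i < 2) top (U.2 i) x1 * (normal P i x1)%:C%C) * (bot V.1 x1)^*%C) -
  Tp U.1 V.1 - Tm U.2 V.2.

Definition A (R : realType) (P : setting R) : hsob R -> hsob R -> R[i] :=
  Agen P (Tplus_pair P) (Tminus_pair P).

Definition APML (R : realType) (P : setting R) : hsob R -> hsob R -> R[i] :=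
  Agen P (TplusPML_pair P) (TminusPML_pair P).

Definition pin (R : realType) (P : setting R) (x : R * R) : R[i] :=
  cexp (0 +i* (alpha P * x.1 - beta P * x.2))%C.

Definition Lrhs (R : realType) (P : setting R) (V : hsob R) : R[i] :=
  int_Gamma P (fun x1 =>
    (\sum_(i < 2) (normal P i x1)%:C%C * cpartial i (pin P) (x1, surf P x1)) *
      (bot V.1 x1)^*%C -
    pin P (x1, surf P x1) *
      \sum_(i < 2) (normal P i x1)%:C%C * (top (V.2 i) x1)^*%C).

(* Jones frequency: a nontrivial radiating elastic field that is traction-free
   (natural condition of the weak form) and purely tangential on Gamma. *)
Definition Jones (R : realType) (P : setting R) : Prop :=
  exists u, [/\ H1minus P u, normminus P u != 0,
    {ae leb1 R, forall x, period P x ->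
       \sum_(i < 2) top (u i) x * (normal P i x)%:C%C = 0} &
    forall psi, H1minus P psi ->
      elastic_form P u psi - Tminus_pair P u psi = 0].

Record standing (R : realType) (P : setting R) : Prop := Standing {
  Lam_gt0 : 0 < Lam P;
  surf_per : forall x, surf P (x + Lam P) = surf P x;
  surf_lip : lipschitz (surf P : R -> R);
  surf_between : forall x, height2 P < surf P x < height1 P;
  delta_gt0 : 0 < delta1 P /\ 0 < delta2 P;
  const_gt0 : [/\ 0 < rhof P, 0 < rho P, 0 < omega P & 0 < kappa P];
  lame_pos : 0 < mu P /\ 0 < lam P + mu P;
  theta_bound : - (pi / 2) < theta P < pi / 2;
  expo_ge1 : 1 <= expo P;
  spml_Re : forall x2, 1 <= complex.Re (spml P x2);
  spml_Im : forall x2,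
    height1 P < x2 < height1 P + delta1 P \/
    height2 P - delta2 P < x2 < height2 P ->
    0 < complex.Im (spml P x2);
  no_cutoff : forall n, [/\ `|alphan P n| != kappa P,
    `|alphan P n| != kappa1 P & `|alphan P n| != kappa2 P];
  not_Jones : ~ Jones P
}.

(* Elements are compared as in the normed space, i.e. up to null sets. *)
Definition heq (R : realType) (P : setting R) (U V : hsob R) : Prop :=
  hnorm P (U - V) = 0.

Definition bounded_antilinear (R : realType) (P : setting R)
    (l : hsob R -> R[i]) : Prop :=
  (forall (c : R[i]) V W, HH P V -> HH P W ->
     l (c *: V + W) = c^*%C * l V + l W) /\
  exists M : R, forall V, HH P V -> cabs (l V) <= M * hnorm P V.

Definition solves (R : realType) (P : setting R)
    (B : hsob R -> hsob R -> R[i]) (l : hsob R -> R[i]) (U : hsob R) : Prop :=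
  HH P U /\ forall V, HH P V -> B U V = l V.

Definition has_unique_solution (R : realType) (P : setting R)
    (B : hsob R -> hsob R -> R[i]) (l : hsob R -> R[i]) : Prop :=
  exists U, solves P B l U /\ forall U', solves P B l U' -> heq P U' U.

Definition dual_norm (R : realType) (P : setting R) (l : hsob R -> R[i])
    : \bar R :=
  ereal_sup [set (cabs (l V) / hnorm P V)%:E |
    V in [set V | HH P V /\ ~ heq P V 0]].

Definition gamma1 (R : realType) (P : setting R) : R :=
  Num.sqrt (1 + (height1 P - height2 P)^-1).

Definition minTheta (R : realType) (P : setting R) (k : R) (S : set int) : R :=
  inf [set Theta P k n | n in S].

(* In a maximum of positive terms, a term indexed by an empty set is dropped
   by giving it the value 0. *)
Definition omit_empty (R : realType) (S : set int) (x : R) : R :=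
  if `[< S !=set0 >] then x else 0.

Definition F1 (R : realType) (P : setting R) : R :=
  let I := prop_modes P (kappa P) in
  let Ti := minTheta P (kappa P) I in
  let Te := minTheta P (kappa P) (~` I) in
  Num.max
    (omit_empty I (2 * Ti / (expR (2 * complex.Im (eta1 P) * Ti) - 1)))
    (omit_empty (~` I) (2 * Te / (expR (2 * complex.Re (eta1 P) * Te) - 1))).

Definition F2_decay (R : realType) (P : setting R) (k : R) : R :=
  let I := prop_modes P k in
  let Ti := minTheta P k I in
  let Te := minTheta P k (~` I) in
  Num.max
    (omit_empty I (Ti / (expR (2^-1 * Ti * complex.Im (eta2 P)) - 1)))
    (omit_empty (~` I) (Te / (expR (2^-1 * Te * complex.Re (eta2 P)) - 1))).

Definition F2 (R : realType) (P : setting R) : R :=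
  let k1 := kappa1 P in
  let k2 := kappa2 P in
  34 * omega P ^+ 2 * rho P / k1 ^+ 4 *
  Num.max (F2_decay P k1) (F2_decay P k2) *
  Num.max (6 * k2) (Num.max (k2 ^+ 2 + 4) (Num.max (8 * k2 ^+ 4)
    (Num.max (8 * k2 ^+ 3 / k1 ^+ 2)
             (12 * (k2 ^+ 2 + 16) ^+ 2 / k1 ^+ 2)))).

Definition trace_inequalities (R : realType) (P : setting R) : Prop :=
  forall V, HH P V ->
    [/\ ((l2norm P (top V.1))%:E <= hhalf P (top V.1))%E,
        (hhalf P (top V.1) <= (gamma1 P * normplus P V.1)%:E)%E,
        ((vl2norm P (fun i => bot (V.2 i)))%:E <=
           vhhalf P (fun i => bot (V.2 i)))%E &
        (vhhalf P (fun i => bot (V.2 i)) <=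
           (gamma1 P * normminus P V.2)%:E)%E].

Definition operator_estimates (R : realType) (P : setting R) : Prop :=
  forall U V, HH P U -> HH P V ->
    cabs (TplusPML_pair P U.1 V.1 - Tplus_pair P U.1 V.1) <=
      F1 P * l2norm P (top U.1) * l2norm P (top V.1) /\
    cabs (TminusPML_pair P U.2 V.2 - Tminus_pair P U.2 V.2) <=
      F2 P * vl2norm P (fun i => bot (U.2 i)) *
             vl2norm P (fun i => bot (V.2 i)).

(* Main.v *)
Require Import Defs.
From mathcomp Require Import all_boot all_order all_algebra.
From mathcomp Require Import all_classical all_reals all_analysis.
From mathcomp Require Import measurable_realfun complex.
From mathcomp Require Import ring lra zify.

Set Implicit Arguments.
Unset Strict Implicit.
Unset Printing Implicit Defensive.

Import Order.TTheory GRing.Theory Num.Theory.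
Import numFieldNormedType.Exports.

Local Open Scope classical_set_scope.
Local Open Scope ring_scope.

(** Let [d = A - A^PML]. Only the boundary operators differ in the two forms, so the
  operator estimates and the trace inequalities bound [d(U, V)] by
  [K |U| |V|] with [K = max (F1, F2) gamma1^2], and [K < gamma0] by hypothesis.
  Writing the PML solution as [U + W], the PML problem becomes
  [A(W, V) = d(U + W, V)] for all [V]. By the inf-sup condition and the unique
  solvability of the problem with form [A], the map sending [W] to the solution of
  [A(W', V) = d(U + W, V)] is a contraction with ratio [K / gamma0].

  The energy norm of the elastic part is complete only through Korn's inequality,
  which is avoided by iterating on the functionals [d(U + W_n, .)] instead of the
  fields: they converge pointwise in the complex numbers, and the limit is
  represented by a field ([perturbed_solvability]). The iteration runs on the
  correction [W] and not on [U + W] because [d(U + W, .)] is bounded by the trace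
  inequalities on the artificial boundaries, whereas the boundedness of [L] would
  rest on one on the interface. Uniqueness is the contraction
  estimate for the difference of two solutions, and the error estimate is the
  identity [A(U - U^PML, V) = - d(U^PML, V)] together with the bound of [d] by the
  traces of [U^PML].

  The rest is to show that the forms are linear where the argument uses it. This is
  not formal, since an integral or a series is additive only where it converges:
  - the spaces are closed under linear combinations ([HH_lin]);
  - the interface integrals contain the derivative of the Lipschitz profile, which
    has to be measurable ([derive1_lipschitz_measurable]) and bounded;
  - the pairings on the artificial boundaries are Fourier series that converge
    because the multipliers grow at most linearly ([Tplus_order_one],
    [TplusPML_order_one], [Wn_order_one]) and the traces lie in [H^{1/2}];
  - the elastic PML operator is defined by a choice of a solution of the layer
    problem and of a lift, and the result does not depend on that choice
    ([TminusPML_pairE]). *)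

(** * Complex-valued square-integrable functions *)

Section ComplexModulus.
Context {R : realType}.
Implicit Types z w : R[i].

Lemma complex_eta z : z = (complex.Re z +i* complex.Im z)%C.
Proof. by case: z. Qed.

Lemma sqr_cabs z : cabs z ^+ 2 = complex.Re z ^+ 2 + complex.Im z ^+ 2.
Proof.
by case: z => a b; rewrite /cabs /= sqr_sqrtr // addr_ge0 ?sqr_ge0.
Qed.

Lemma cabs_ge0 z : 0 <= cabs z.
Proof. by case: z => a b; exact: sqrtr_ge0. Qed.

Lemma cabs0 : cabs (0 : R[i]) = 0.
Proof. exact: ComplexField.Normc.normc0. Qed.

Lemma cabsM z w : cabs (z * w) = cabs z * cabs w.
Proof. exact: ComplexField.Normc.normcM. Qed.

Lemma cabsV z : cabs z^-1 = (cabs z)^-1.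
Proof. exact: ComplexField.Normc.normcV. Qed.

Lemma cabsN z : cabs (- z) = cabs z.
Proof. by case: z => a b; rewrite /cabs /= !sqrrN. Qed.

Lemma cabsJ z : cabs z^*%C = cabs z.
Proof. by case: z => a b; rewrite /cabs /= sqrrN. Qed.

Lemma cabsD z w : cabs (z + w) <= cabs z + cabs w.
Proof.
have := @ler_normD R[i] R[i] z w; rewrite !normc_def -rmorphD lecR.
by case: z w => a b [c d0].
Qed.

Lemma cabs_real (a : R) : cabs a%:C%C = `|a|.
Proof. by rewrite /cabs /= expr0n addr0 sqrtr_sqr. Qed.

Lemma cabs_imag (a : R) : cabs (0 +i* a)%C = `|a|.
Proof. by rewrite /cabs /= expr0n add0r sqrtr_sqr. Qed.

Lemma Re_mulc z w : complex.Re (z * w) =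
  complex.Re z * complex.Re w - complex.Im z * complex.Im w.
Proof. by case: z w => a b [c d]. Qed.

Lemma Im_mulc z w : complex.Im (z * w) =
  complex.Re z * complex.Im w + complex.Im z * complex.Re w.
Proof. by case: z w => a b [c d]. Qed.

Lemma Re_addc z w : complex.Re (z + w) = complex.Re z + complex.Re w.
Proof. by case: z w => a b [c d]. Qed.

Lemma Im_addc z w : complex.Im (z + w) = complex.Im z + complex.Im w.
Proof. by case: z w => a b [c d]. Qed.

Lemma Re_conj_c z : complex.Re z^*%C = complex.Re z.
Proof. by case: z. Qed.

Lemma Im_conj_c z : complex.Im z^*%C = - complex.Im z.
Proof. by case: z. Qed.

Lemma ler_Re_cabs z : `|complex.Re z| <= cabs z.
Proof.
rewrite -(ler_pXn2r (n := 2)) ?nnegrE ?cabs_ge0//.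
by rewrite sqr_cabs real_normK ?num_real// lerDl sqr_ge0.
Qed.

Lemma ler_Im_cabs z : `|complex.Im z| <= cabs z.
Proof.
rewrite -(ler_pXn2r (n := 2)) ?nnegrE ?cabs_ge0//.
by rewrite sqr_cabs real_normK ?num_real// lerDr sqr_ge0.
Qed.

Lemma cabs_le_ReIm z : cabs z <= `|complex.Re z| + `|complex.Im z|.
Proof.
rewrite -(ler_pXn2r (n := 2)) ?nnegrE ?cabs_ge0 ?addr_ge0//.
rewrite sqr_cabs sqrrD !real_normK ?num_real//.
rewrite addrAC lerDl.
by rewrite mulrn_wge0 ?mulr_ge0.
Qed.

Lemma cabs_eq0 z : cabs z = 0 -> z = 0.
Proof. exact: ComplexField.Normc.eq0_normc. Qed.

Lemma sqr_cabsD z w : cabs (z + w) ^+ 2 <= 2 * (cabs z ^+ 2 + cabs w ^+ 2).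
Proof.
rewrite !sqr_cabs Re_addc Im_addc.
have := sqr_ge0 (complex.Re z - complex.Re w).
have := sqr_ge0 (complex.Im z - complex.Im w).
rewrite !expr2; nra.
Qed.

Lemma cabs_mul_le z w : cabs (z * w) <= cabs z ^+ 2 + cabs w ^+ 2.
Proof.
rewrite cabsM; have := sqr_ge0 (cabs z - cabs w).
have := cabs_ge0 z; have := cabs_ge0 w; rewrite !expr2; nra.
Qed.

End ComplexModulus.

Section ComplexIntegral.
Context d (T : measurableType d) (R : realType).
Variables (mu : {measure set T -> \bar R}) (D : set T).
Hypothesis mD : measurable D.
Implicit Types f g h : T -> R[i].

Definition cmeas f := measurable_fun D (fun x => complex.Re (f x)) /\
  measurable_fun D (fun x => complex.Im (f x)).

Definition cintegrable f :=
  mu.-integrable D (EFin \o (fun x => complex.Re (f x))) /\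
  mu.-integrable D (EFin \o (fun x => complex.Im (f x))).

Lemma cmeasD f g : cmeas f -> cmeas g -> cmeas (fun x => f x + g x).
Proof.
move=> [f1 f2] [g1 g2]; split.
- by under eq_fun do rewrite Re_addc; exact: measurable_funD.
- by under eq_fun do rewrite Im_addc; exact: measurable_funD.
Qed.

Lemma cmeasM f g : cmeas f -> cmeas g -> cmeas (fun x => f x * g x).
Proof.
move=> [f1 f2] [g1 g2]; split.
- under eq_fun do rewrite Re_mulc.
  by apply: measurable_funB; exact: measurable_funM.
- under eq_fun do rewrite Im_mulc.
  by apply: measurable_funD; exact: measurable_funM.
Qed.

Lemma cmeas_cst (c : R[i]) : cmeas (fun=> c).
Proof. by split; exact: measurable_cst. Qed.

Lemma cmeas_lin (c : R[i]) f g : cmeas f -> cmeas g ->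
  cmeas (fun x => c * f x + g x).
Proof.
by move=> mf mg; apply: cmeasD mg; apply: cmeasM mf; exact: cmeas_cst.
Qed.

Lemma cmeasN f : cmeas f -> cmeas (fun x => - f x).
Proof.
move=> mf; rewrite (_ : (fun x => - f x) = fun x => (- 1) * f x).
  by apply: cmeasM => //; exact: cmeas_cst.
by apply/funext => x; rewrite mulN1r.
Qed.

Lemma cmeasB f g : cmeas f -> cmeas g -> cmeas (fun x => f x - g x).
Proof. by move=> mf mg; apply: cmeasD => //; exact: cmeasN. Qed.

Lemma cmeasJ f : cmeas f -> cmeas (fun x => (f x)^*%C).
Proof.
move=> [f1 f2]; split.
- by under eq_fun do rewrite Re_conj_c.
- under eq_fun do rewrite Im_conj_c.
  exact: (measurableT_comp (measurable_funN (@measurable_id _ _ setT))).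
Qed.

Lemma cmeas_real (f : T -> R) : measurable_fun D f -> cmeas (fun x => (f x)%:C%C).
Proof. by move=> mf; split => //=; exact: measurable_cst. Qed.

Lemma cmeas_sqr f : cmeas f -> measurable_fun D (fun x => cabs (f x) ^+ 2).
Proof.
move=> [f1 f2]; under eq_fun do rewrite sqr_cabs.
by apply: measurable_funD; exact: measurable_funX.
Qed.

Lemma cmeas_cabs f : cmeas f -> measurable_fun D (fun x => cabs (f x)).
Proof.
move=> mf; rewrite (_ : (fun x => _) = fun x => (cabs (f x) ^+ 2) `^ 2^-1).
  apply: (@measurableT_comp _ _ _ _ _ _ (@powR R ^~ 2^-1)).
    exact: measurable_powR.
  exact: cmeas_sqr.
apply/funext => x; rewrite -powR_mulrn ?cabs_ge0// -powRrM divff//.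
by rewrite powRr1 ?cabs_ge0.
Qed.

Lemma L2_cmeas f : L2 mu D f -> cmeas f.
Proof. by case. Qed.

Lemma L2P f : L2 mu D f <->
  cmeas f /\ mu.-integrable D (EFin \o (fun x => cabs (f x) ^+ 2)).
Proof.
split=> [[f1 f2 f3]|[[f1 f2] /integrableP[_ fi]]].
- have mf : cmeas f by split.
  split=> //; apply/integrableP; split.
    by apply/measurable_EFinP; exact: cmeas_sqr.
  by under eq_integral do rewrite /= ger0_norm ?sqr_ge0//.
- split=> //; move: fi.
  by under eq_integral do rewrite /= ger0_norm ?sqr_ge0//.
Qed.

Lemma cintegrable_le f (b : T -> R) : cmeas f ->
  mu.-integrable D (EFin \o b) -> (forall x, D x -> cabs (f x) <= b x) ->
  cintegrable f.
Proof.
move=> [f1 f2] ib le; split.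
- apply: (le_integrable mD _ _ ib); first exact/measurable_EFinP.
  move=> x Dx; rewrite /= lee_fin (le_trans (ler_Re_cabs _))//.
  by rewrite (le_trans (le _ Dx))// ler_norm.
- apply: (le_integrable mD _ _ ib); first exact/measurable_EFinP.
  move=> x Dx; rewrite /= lee_fin (le_trans (ler_Im_cabs _))//.
  by rewrite (le_trans (le _ Dx))// ler_norm.
Qed.

Lemma integrable_realD (f g : T -> R) : mu.-integrable D (EFin \o f) ->
  mu.-integrable D (EFin \o g) ->
  mu.-integrable D (EFin \o (fun x => f x + g x)).
Proof. by move=> fi gi; have := integrableD mD fi gi. Qed.

Lemma integrable_realZ (k : R) (f : T -> R) : mu.-integrable D (EFin \o f) ->
  mu.-integrable D (EFin \o (fun x => k * f x)).
Proof. by move=> fi; have := integrableZl mD k fi. Qed.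

Lemma cintegrableD f g : cintegrable f -> cintegrable g ->
  cintegrable (fun x => f x + g x).
Proof.
move=> [f1 f2] [g1 g2]; split.
- rewrite (_ : (fun x => _) = fun x => complex.Re (f x) + complex.Re (g x)).
    exact: integrable_realD.
  by apply/funext => x; rewrite Re_addc.
- rewrite (_ : (fun x => _) = fun x => complex.Im (f x) + complex.Im (g x)).
    exact: integrable_realD.
  by apply/funext => x; rewrite Im_addc.
Qed.

Lemma cintegrableZ (c : R[i]) f : cintegrable f -> cintegrable (fun x => c * f x).
Proof.
move=> [f1 f2]; split.
- rewrite (_ : (fun x => _) = fun x => complex.Re c * complex.Re (f x)
    + (- complex.Im c) * complex.Im (f x)).
    by apply: integrable_realD; exact: integrable_realZ.
  by apply/funext => x; rewrite Re_mulc mulNr.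
- rewrite (_ : (fun x => _) = fun x => complex.Re c * complex.Im (f x)
    + complex.Im c * complex.Re (f x)).
    by apply: integrable_realD; exact: integrable_realZ.
  by apply/funext => x; rewrite Im_mulc.
Qed.

Lemma cintegrableN f : cintegrable f -> cintegrable (fun x => - f x).
Proof.
move=> /(cintegrableZ (-1)); congr (cintegrable _).
by apply/funext => x; rewrite mulN1r.
Qed.

Lemma cintegrableB f g : cintegrable f -> cintegrable g ->
  cintegrable (fun x => f x - g x).
Proof. by move=> fi gi; apply: cintegrableD => //; exact: cintegrableN. Qed.

Lemma cintegrable0 : cintegrable (fun=> 0).
Proof. by split; exact: integrable0. Qed.

Lemma cintegrable_sum (I : Type) (s : seq I) (F : I -> T -> R[i]) :
  (forall i, cintegrable (F i)) -> cintegrable (fun x => \sum_(i <- s) F i x).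
Proof.
move=> Fi; elim: s => [|i s ih].
  by under [X in cintegrable X]funext do rewrite big_nil; exact: cintegrable0.
rewrite (_ : (fun x => _) = fun x => F i x + \sum_(i <- s) F i x).
  exact: cintegrableD.
by apply/funext => x; rewrite big_cons.
Qed.

Lemma eq_cint f g : (forall x, D x -> f x = g x) -> cint mu D f = cint mu D g.
Proof.
move=> e; rewrite /cint; congr (_ +i* _)%C; apply: eq_Rintegral => x.
all: by rewrite inE => Dx; rewrite e.
Qed.

Lemma cint_lin (c : R[i]) f g : cintegrable f -> cintegrable g ->
  cint mu D (fun x => c * f x + g x) = c * cint mu D f + cint mu D g.
Proof.
move=> fi gi; have [[[c1 c2] [f1 f2]] [g1 g2]] := (cintegrableZ c fi, fi, gi).
rewrite [RHS]complex_eta Re_addc Im_addc Re_mulc Im_mulc.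
rewrite /cint /=; congr (_ +i* _)%C.
- under eq_Rintegral do rewrite Re_addc; rewrite RintegralD//; congr (_ + _).
  under eq_Rintegral do rewrite Re_mulc; rewrite RintegralB//; first last.
  + exact: integrable_realZ.
  + exact: integrable_realZ.
  by rewrite !RintegralZl.
- under eq_Rintegral do rewrite Im_addc; rewrite RintegralD//; congr (_ + _).
  under eq_Rintegral do rewrite Im_mulc; rewrite RintegralD//; first last.
  + exact: integrable_realZ.
  + exact: integrable_realZ.
  by rewrite !RintegralZl.
Qed.

Lemma L2D f g : L2 mu D f -> L2 mu D g -> L2 mu D (fun x => f x + g x).
Proof.
move=> /L2P[mf fi] /L2P[mg gi]; apply/L2P; split; first exact: cmeasD.
apply: (le_integrable mD _ _ (integrable_realZ 2 (integrable_realD fi gi))).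
  by apply/measurable_EFinP; apply: cmeas_sqr; exact: cmeasD.
move=> x Dx; rewrite /= lee_fin !ger0_norm ?sqr_ge0//.
  exact: sqr_cabsD.
by rewrite mulr_ge0// addr_ge0 ?sqr_ge0.
Qed.

Lemma L2_bounded (M : R) (m : T -> R[i]) f : cmeas m ->
  (forall x, D x -> cabs (m x) <= M) -> L2 mu D f ->
  L2 mu D (fun x => m x * f x).
Proof.
move=> mm bm /L2P[mf fi]; apply/L2P; split; first exact: cmeasM.
apply: (le_integrable mD _ _ (integrable_realZ (M ^+ 2) fi)).
  by apply/measurable_EFinP; apply: cmeas_sqr; exact: cmeasM.
move=> x Dx; rewrite /= lee_fin !ger0_norm ?sqr_ge0//; last first.
  by rewrite mulr_ge0 ?sqr_ge0.
rewrite cabsM exprMn ler_wpM2r ?sqr_ge0//.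
by rewrite ler_pXn2r ?nnegrE ?cabs_ge0 ?bm// (le_trans _ (bm _ Dx)) ?cabs_ge0.
Qed.

Lemma L2Z (c : R[i]) f : L2 mu D f -> L2 mu D (fun x => c * f x).
Proof. by apply: (L2_bounded (M := cabs c)) => //; exact: cmeas_cst. Qed.

Lemma L2_lin (c : R[i]) f g : L2 mu D f -> L2 mu D g ->
  L2 mu D (fun x => c * f x + g x).
Proof. by move=> Lf Lg; apply: L2D => //; exact: L2Z. Qed.

Lemma L2J f : L2 mu D f -> L2 mu D (fun x => (f x)^*%C).
Proof.
move=> /L2P[mf fi]; apply/L2P; split; first exact: cmeasJ.
by rewrite (_ : (fun x => _) = fun x => cabs (f x) ^+ 2)//;
  apply/funext => x; rewrite cabsJ.
Qed.

Lemma L2_0 : L2 mu D (fun=> 0).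
Proof.
apply/L2P; split; first exact: cmeas_cst.
rewrite (_ : _ \o _ = cst 0%E); first exact: integrable0.
by apply/funext => x; rewrite /comp cabs0 expr0n.
Qed.

Lemma L2_sum (I : Type) (s : seq I) (F : I -> T -> R[i]) :
  (forall i, L2 mu D (F i)) -> L2 mu D (fun x => \sum_(i <- s) F i x).
Proof.
move=> FL; elim: s => [|i s ih].
  by under [X in L2 _ _ X]funext do rewrite big_nil; exact: L2_0.
rewrite (_ : (fun x => _) = fun x => F i x + \sum_(i <- s) F i x).
  exact: L2D.
by apply/funext => x; rewrite big_cons.
Qed.

Lemma L2M f g : L2 mu D f -> L2 mu D g -> cintegrable (fun x => f x * g x).
Proof.
move=> /L2P[mf fi] /L2P[mg gi].
apply: (cintegrable_le _ (integrable_realD fi gi)); first exact: cmeasM.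
by move=> x _; exact: cabs_mul_le.
Qed.

Lemma L2MJ f g : L2 mu D f -> L2 mu D g ->
  cintegrable (fun x => f x * (g x)^*%C).
Proof. by move=> Lf Lg; apply: L2M => //; exact: L2J. Qed.

Lemma bounded_L2 (M : R) f : (mu D < +oo)%E -> cmeas f ->
  (forall x, D x -> cabs (f x) <= M) -> L2 mu D f.
Proof.
move=> fD mf bf; apply/L2P; split => //.
have iM : mu.-integrable D (EFin \o cst (M ^+ 2)).
  by apply: measurable_bounded_integrable => //; exact: bounded_cst.
apply: (le_integrable mD _ _ iM).
  by apply/measurable_EFinP; exact: cmeas_sqr.
move=> x Dx; rewrite /= lee_fin !ger0_norm ?sqr_ge0//.
by rewrite ler_pXn2r ?nnegrE ?cabs_ge0 ?bf// (le_trans _ (bf _ Dx)) ?cabs_ge0.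
Qed.

(** Follows from [|c z + w|^2 <= 2 (|c|^2 |z|^2 + |w|^2)]. This is what makes the
  approximation by smooth functions, through which traces are defined, stable
  under linear combinations. *)
Lemma L2cvg_lin (c : R[i]) (f g : nat -> T -> R[i]) :
  (forall k, cmeas (f k)) -> (forall k, cmeas (g k)) ->
  (\int[mu]_(x in D) ((cabs (f k x) ^+ 2)%:E))%E @[k --> \oo] --> 0%E ->
  (\int[mu]_(x in D) ((cabs (g k x) ^+ 2)%:E))%E @[k --> \oo] --> 0%E ->
  (\int[mu]_(x in D) ((cabs (c * f k x + g k x) ^+ 2)%:E))%E
    @[k --> \oo] --> 0%E.
Proof.
move=> mf mg cf cg.
pose F k := (\int[mu]_(x in D) ((cabs (f k x) ^+ 2)%:E))%E.
pose G k := (\int[mu]_(x in D) ((cabs (g k x) ^+ 2)%:E))%E.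
have mE h : cmeas h -> measurable_fun D (fun x => (cabs (h x) ^+ 2)%:E).
  by move=> mh; apply/measurable_EFinP; exact: cmeas_sqr.
have nn (z : R[i]) : (0 <= (cabs z ^+ 2)%:E)%E by rewrite lee_fin sqr_ge0.
pose b := 2 * cabs c ^+ 2.
have b0 : 0 <= b by rewrite mulr_ge0 ?sqr_ge0.
have up : ((fun k => b%:E * F k + 2%:E * G k) @ \oo --> 0)%E.
  rewrite [X in _ --> X](_ : _ = b%:E * 0 + 2%:E * 0)%E; last by rewrite !mule0 adde0.
  apply: cvgeD; first by rewrite !mule0.
  - by apply: cvgeZl => //.
  - by apply: cvgeZl => //.
apply: (@squeeze_cvge _ _ _ _ (cst 0%E) _ _ _ _ (cvg_cst 0%E) up).
apply: nearW => k; apply/andP; split; first by apply: integral_ge0 => x _; exact: nn.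
have := (mE _ (mf k), mE _ (mg k)) => -[mfk mgk].
rewrite /F /G -!ge0_integralZl// -ge0_integralD//.
- apply: ge0_le_integral => //.
  + by apply: (mE (fun x => c * f k x + g k x)); exact: cmeas_lin.
  + by apply: emeasurable_funD; exact: measurable_funeM.
  + move=> x _; rewrite -!EFinM -EFinD lee_fin (le_trans (sqr_cabsD _ _))//.
    by rewrite cabsM exprMn /b mulrDr !mulrA.
- by move=> x _; rewrite mule_ge0 ?nn// lee_fin.
- exact: measurable_funeM.
- by move=> x _; rewrite mule_ge0 ?nn// lee_fin.
- exact: measurable_funeM.
Qed.

Lemma L2_null f : L2 mu D f -> Rintegral mu D (fun x => cabs (f x) ^+ 2) = 0 ->
  {ae mu, forall x, D x -> f x = 0}.
Proof.
move=> /L2P[mf fi] i0.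
have m1 : measurable_fun D (fun x => (cabs (f x) ^+ 2)%:E).
  by apply/measurable_EFinP; exact: cmeas_sqr.
have h0 : (\int[mu]_(x in D) `|(cabs (f x) ^+ 2)%:E| = 0)%E.
  under eq_integral do rewrite gee0_abs ?lee_fin ?sqr_ge0//.
  have fn := integrable_fin_num mD fi.
  by rewrite -[LHS]fineK ?fn// [fine _]i0.
have /(ae_eq_integral_abs mu mD m1) := h0.
apply: filterS => x h Dx; apply: cabs_eq0; apply/eqP.
by have /eqP := h Dx; rewrite eqe sqrf_eq0.
Qed.

Lemma cint_ae0 f : cmeas f -> {ae mu, forall x, D x -> f x = 0} ->
  cint mu D f = 0.
Proof.
move=> [f1 f2] f0; rewrite /cint /Rintegral.
have z (h : T -> R) : measurable_fun D h ->
    {ae mu, forall x, D x -> h x = 0} -> (\int[mu]_(x in D) (h x)%:E = 0)%E.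
  move=> mh h0; rewrite (ae_eq_integral (cst 0%E))//.
  - by rewrite integral0.
  - exact/measurable_EFinP.
  - by apply: filterS h0 => x h0 Dx; rewrite h0.
rewrite !z//; apply: filterS f0 => x h Dx; by rewrite h.
Qed.

End ComplexIntegral.

(** * The quasi-periodic Sobolev spaces are vector spaces *)

(** The squares with rational centre and radius form a countable base of the
  plane, and they are measurable rectangles. *)
Lemma open_measurable2 (R : realType) (A : set (R * R)) : open A -> measurable A.
Proof.
move=> oA; pose box (q r e : rat) : set (R * R) :=
  ball (ratr q : R) (ratr e) `*` ball (ratr r : R) (ratr e).
rewrite (_ : A = \bigcup_(q : rat) \bigcup_(r : rat) \bigcup_(e : rat)
    (if `[< box q r e `<=` A >] then box q r e else set0)).
  do 3 (apply: bigcupT_measurable_rat => ?).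
  by case: ifP => // _; apply: measurableX; exact: measurable_ball.
apply/seteqP; split=> [[x y] Axy|p [q _ [r _ [e _]]]]; last first.
  by case: ifPn => // /asboolP; exact.
have /nbhs_ballP[eps /= eps0 sub] := open_nbhs_nbhs (conj oA Axy).
have [e] : exists e, (ratr e : R) \in `]0, (eps / 2)[.
  by apply: rat_in_itvoo; rewrite divr_gt0.
rewrite in_itv /= => /andP[e0 e2].
have near (z : R) : exists q, ball (ratr q : R) (ratr e) z.
  have [q] : exists q, (ratr q : R) \in `](z - ratr e), z[.
    by apply: rat_in_itvoo; rewrite ltrBlDr ltrDl.
  rewrite in_itv /= => /andP[q1 q2]; exists q.
  by rewrite -ball_normE /= ltr_norml; apply/andP; split; lra.
have [[q qx] [r ry]] := (near x, near y).
exists q => //; exists r => //; exists e => //.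
case: ifPn => // /asboolPn; case=> -[x' y'] [/= qx' ry']; apply: sub; split=> /=.
- apply: (@le_ball _ _ _ (ratr e + ratr e)); first lra.
  exact: ball_triangle (ball_sym qx) qx'.
- apply: (@le_ball _ _ _ (ratr e + ratr e)); first lra.
  exact: ball_triangle (ball_sym ry) ry'.
Qed.

Lemma continuous_measurable2 (R : realType) (g : R * R -> R) :
  continuous g -> measurable_fun setT g.
Proof.
move=> /continuousP cg; apply: (measurability _ (RGenOpens.measurableE R)).
move=> _ [_ [a [b ->] <-]]; rewrite setTI.
by apply: open_measurable2; apply: cg; exact: interval_open.
Qed.

Section SmoothFunctions.
Context {R : realType}.
Implicit Types g h : R * R -> R.

Lemma derivable_lincomb (a b : R) g h x v :
  derivable g x v -> derivable h x v ->
  derivable (fun y => a * g y + b * h y) x v.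
Proof.
by move=> dg dh; apply: derivableD; apply: derivableZ.
Qed.

Lemma derive_lincomb (a b : R) g h x v :
  derivable g x v -> derivable h x v ->
  'D_v (fun y => a * g y + b * h y) x = a * 'D_v g x + b * 'D_v h x.
Proof.
move=> dg dh.
rewrite (_ : (fun y => _) = (a \*: g) \+ (b \*: h))//.
have da : derivable (a \*: g) x v by exact: derivableZ.
have db : derivable (b \*: h) x v by exact: derivableZ.
by rewrite (deriveD da db) (deriveZ a dg) (deriveZ b dh).
Qed.

Lemma Ck_lin k (a b : R) g h : Ck k g -> Ck k h ->
  Ck k (fun x => a * g x + b * h x).
Proof.
elim: k g h => [|k ih] g h [cg dg] [ch dh]; split=> //.
- move=> x; apply: cvgD; apply: cvgM; try exact: cvg_cst; [exact: cg|exact: ch].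
- move=> x; apply: cvgD; apply: cvgM; try exact: cvg_cst; [exact: cg|exact: ch].
- move=> i; have [[gi gk] [hi hk]] := (dg i, dh i); split.
    by move=> x; exact: derivable_lincomb.
  rewrite (_ : (fun x => _) =
      fun x => a * 'D_(basis2 R i) g x + b * 'D_(basis2 R i) h x).
    exact: ih.
  by apply/funext => x; rewrite derive_lincomb.
Qed.

Lemma smooth_continuous g : smooth g -> continuous g.
Proof. by move=> /(_ 0) []. Qed.

Lemma smooth_derivable g i x : smooth g -> derivable g x (basis2 R i).
Proof. by move=> /(_ 1) [_ /(_ i) []]. Qed.

Lemma smooth_derive_continuous g i :
  smooth g -> continuous (fun x => 'D_(basis2 R i) g x).
Proof. by move=> /(_ 1) [_ /(_ i) [_ []]]. Qed.

Lemma csmooth_lin (c : R[i]) (f g : R * R -> R[i]) :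
  csmooth f -> csmooth g -> csmooth (fun x => c * f x + g x).
Proof.
move=> [f1 f2] [g1 g2]; split=> k.
- rewrite (_ : (fun x => _) = fun x => 1 * (complex.Re c * complex.Re (f x) +
    (- complex.Im c) * complex.Im (f x)) + 1 * complex.Re (g x)).
    by apply: Ck_lin => //; exact: Ck_lin.
  by apply/funext => x; rewrite Re_addc Re_mulc mulNr !mul1r.
- rewrite (_ : (fun x => _) = fun x => 1 * (complex.Re c * complex.Im (f x) +
    complex.Im c * complex.Re (f x)) + 1 * complex.Im (g x)).
    by apply: Ck_lin => //; exact: Ck_lin.
  by apply/funext => x; rewrite Im_addc Im_mulc !mul1r.
Qed.

Lemma cpartial_lin (c : R[i]) (f g : R * R -> R[i]) i x :
  csmooth f -> csmooth g ->
  cpartial i (fun x => c * f x + g x) x = c * cpartial i f x + cpartial i g x.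
Proof.
move=> [f1 f2] [g1 g2].
rewrite [RHS]complex_eta Re_addc Im_addc Re_mulc Im_mulc /cpartial /=.
have dr h : smooth h -> derivable h x (basis2 R i) by exact: smooth_derivable.
have := (dr _ f1, dr _ f2, dr _ g1, dr _ g2) => -[[[df1 df2] dg1] dg2].
congr (_ +i* _)%C.
- rewrite (_ : (fun y => _) = fun y => 1 * (complex.Re c * complex.Re (f y) +
    (- complex.Im c) * complex.Im (f y)) + 1 * complex.Re (g y)).
    have dl := @derivable_lincomb (complex.Re c) (- complex.Im c) _ _ _ _ df1 df2.
    rewrite (@derive_lincomb 1 1 _ _ _ _ dl dg1) (@derive_lincomb _ _ _ _ _ _ df1 df2).
    by rewrite mulNr !mul1r.
  by apply/funext => y; rewrite Re_addc Re_mulc mulNr !mul1r.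
- rewrite (_ : (fun y => _) = fun y => 1 * (complex.Re c * complex.Im (f y) +
    complex.Im c * complex.Re (f y)) + 1 * complex.Im (g y)).
    have dl := @derivable_lincomb (complex.Re c) (complex.Im c) _ _ _ _ df2 df1.
    rewrite (@derive_lincomb 1 1 _ _ _ _ dl dg2) (@derive_lincomb _ _ _ _ _ _ df2 df1).
    by rewrite !mul1r.
  by apply/funext => y; rewrite Im_addc Im_mulc !mul1r.
Qed.

Lemma csmooth_cmeas D (f : R * R -> R[i]) : csmooth f -> cmeas D f.
Proof.
by move=> [f1 f2]; split; apply: measurable_funTS;
  apply: continuous_measurable2; exact: smooth_continuous.
Qed.

Lemma cpartial_cmeas D i (f : R * R -> R[i]) :
  csmooth f -> cmeas D (cpartial i f).
Proof.
by move=> [f1 f2]; split; apply: measurable_funTS;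
  apply: continuous_measurable2; exact: smooth_derive_continuous.
Qed.

Lemma csmooth_curve_cmeas (J : set (measurableTypeR R)) (f : R * R -> R[i]) (c : R -> R * R) :
  measurable J -> csmooth f -> continuous c -> cmeas J (fun y => f (c y)).
Proof.
move=> mJ [f1 f2] cc.
have m (g : R * R -> R) : continuous g -> measurable_fun J (fun y => g (c y)).
  move=> cg; apply: measurable_funTS; apply: continuous_measurable_fun => y.
  exact: (@continuous_comp _ _ _ c g _ (cc y) (cg (c y))).
by split; [apply: (m (fun x => complex.Re (f x)))
  |apply: (m (fun x => complex.Im (f x)))]; exact: smooth_continuous.
Qed.

End SmoothFunctions.

Section SobolevOnStrip.
Context {R : realType}.
Implicit Types (P : setting R) (a b : R -> R) (v w : sob R).

Lemma fn_lin (c : R[i]) v w x : fn (c *: v + w) x = c * fn v x + fn w x.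
Proof. by []. Qed.

Lemma pd_lin (c : R[i]) v w i x : pd (c *: v + w) i x = c * pd v i x + pd w i x.
Proof. by []. Qed.

(** What is used of the two curves that bound a strip: the strip is then
  measurable and contained in a compact rectangle. *)
Definition tame_profiles a b := [/\ continuous a, continuous b &
  exists M, forall x, `|a x| <= M /\ `|b x| <= M].

Lemma strip_measurable P a b : tame_profiles a b ->
  measurable (strip P a b : set (measurableTypeR R * measurableTypeR R)).
Proof.
move=> [ca cb _].
have ma : measurable_fun setT (fun x : R * R => a x.1).
  by apply: (measurableT_comp (continuous_measurable_fun ca)); exact: measurable_fst.
have mb : measurable_fun setT (fun x : R * R => b x.1).
  by apply: (measurableT_comp (continuous_measurable_fun cb)); exact: measurable_fst.
have mc (k : R) : measurable_fun setT (fun _ : R * R => k) by exact: measurable_cst.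
have lt_meas (f g : R * R -> R) : measurable_fun setT f -> measurable_fun setT g ->
    measurable [set x | f x < g x].
  move=> mf mg; have mt : measurable [set true] by [].
  have := measurable_fun_ltr mf mg measurableT mt.
  by rewrite setTI; congr measurable; apply/seteqP; split=> x.
rewrite (_ : strip P a b =
    ([set x | 0 < x.1] `&` [set x | x.1 < Lam P]) `&`
    ([set x | a x.1 < x.2] `&` [set x | x.2 < b x.1])).
  have := lt_meas _ _ (mc 0) measurable_fst.
  have := lt_meas _ _ measurable_fst (mc (Lam P)).
  have := lt_meas _ _ ma measurable_snd.
  have := lt_meas _ _ measurable_snd mb.
  by move=> *; do ! apply: measurableI.
apply/seteqP; split=> x /=.
  by move=> [/andP[? ?] /andP[? ?]].
by move=> [[? ?] [? ?]]; split; exact/andP.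
Qed.

Lemma strip_sub_rectangle P a b : tame_profiles a b -> exists M,
  strip P a b `<=` `[0, Lam P]%classic `*` `[- M, M]%classic.
Proof.
move=> [_ _ [M ab]]; exists M => x [/andP[x0 xL] /andP[ax xb]].
split=> /=; rewrite in_itv /=; first by rewrite !ltW.
have [aM bM] := ab x.1.
move: aM bM; rewrite !ler_norml => /andP[a1 a2] /andP[b1 b2].
by apply/andP; split; lra.
Qed.

Lemma strip_finite_measure P a b : tame_profiles a b ->
  (leb2 R (strip P a b) < +oo)%E.
Proof.
move=> ab; have [M sub] := strip_sub_rectangle P ab.
have mr : measurable (`[0, Lam P]%classic `*` `[- M, M]%classic : set (R * R)).
  exact: measurableX.
apply: (@le_lt_trans _ _ (leb2 R (`[0, Lam P]%classic `*` `[- M, M]%classic))).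
  by apply: le_measure => //; rewrite inE //; exact: strip_measurable.
have fin (x y : R) : (lebesgue_measure `[x, y]%classic < +oo)%E.
  by rewrite lebesgue_measure_itv /=; case: ifPn => _; rewrite -?EFinB ltry.
rewrite /leb2 product_measure1E//= lte_mul_pinfty//.
by rewrite ge0_fin_numE.
Qed.

Lemma continuous_bounded_strip P a b (g : R * R -> R) : tame_profiles a b ->
  continuous g -> exists B, forall x, strip P a b x -> `|g x| <= B.
Proof.
move=> ab cg; have [M sub] := strip_sub_rectangle P ab.
have cK : compact (`[0, Lam P]%classic `*` `[- M, M]%classic : set (R * R)).
  by apply: compact_setX; exact: segment_compact.
have /compact_bounded[B [_ Bb]] :
    compact (g @` (`[0, Lam P]%classic `*` `[- M, M]%classic)).
  by apply: continuous_compact => //; exact: continuous_subspaceT.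
exists (B + 1) => x /sub Kx; apply: (Bb (B + 1)); first by rewrite ltrDl.
by exists x.
Qed.

(** Makes the two sides of the integration by parts formula of a weak derivative
  additive: a test function and its derivatives are bounded on the strip. *)
Lemma L2_times_continuous P a b (f : R * R -> R[i]) (g : R * R -> R) :
  tame_profiles a b -> continuous g -> L2 (leb2 R) (strip P a b) f ->
  cintegrable (leb2 R) (strip P a b) (fun x => f x * (g x)%:C%C).
Proof.
move=> ab cg Lf; have mD := strip_measurable P ab.
have [B gB] := continuous_bounded_strip P ab cg.
apply: L2M => //; apply: (@bounded_L2 _ _ _ (leb2 R) _ _ B) => //.
- exact: strip_finite_measure.
- by apply: cmeas_real; apply: measurable_funTS; exact: continuous_measurable2.
- by move=> x Dx; rewrite cabs_real gB.
Qed.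

Lemma weak_partial_lin P a b (c : R[i]) (v w g h : R * R -> R[i]) i :
  tame_profiles a b -> let D := strip P a b in
  L2 (leb2 R) D v -> L2 (leb2 R) D w -> L2 (leb2 R) D g -> L2 (leb2 R) D h ->
  weak_partial D v g i -> weak_partial D w h i ->
  weak_partial D (fun x => c * v x + w x) (fun x => c * g x + h x) i.
Proof.
move=> ab D Lv Lw Lg Lh vg wh phi tphi; have [sphi _] := tphi.
have mD := strip_measurable P ab.
have cphi := smooth_continuous sphi.
have cdphi := @smooth_derive_continuous _ _ i sphi.
have split_lin (f f' : R * R -> R[i]) (k : R * R -> R) :
    (fun x => (c * f x + f' x) * (k x)%:C%C) =
    fun x => c * (f x * (k x)%:C%C) + f' x * (k x)%:C%C.
  by apply/funext => x; rewrite mulrDl mulrA.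
rewrite !split_lin !cint_lin//; try exact: L2_times_continuous.
by rewrite vg// wh// mulrN opprD.
Qed.

(** The linear combination of two approximating sequences approximates the linear
  combination, in the interior and on the curve. *)
Lemma is_trace_lin D (J : set (measurableTypeR R)) (c : R -> R * R) (z : R[i])
    v v' (w w' : R -> R[i]) :
  measurable D -> measurable J -> continuous c ->
  L2 (leb2 R) D (fn v) -> L2 (leb2 R) D (fn v') ->
  (forall i, L2 (leb2 R) D (pd v i)) -> (forall i, L2 (leb2 R) D (pd v' i)) ->
  is_trace D v c J w -> is_trace D v' c J w' ->
  is_trace D (z *: v + v') c J (fun y => z * w y + w' y).
Proof.
move=> mD mJ cc Lv Lv' Lpv Lpv' [Lw [Phi [s1 s2 s3 s4]]] [Lw' [Psi [t1 t2 t3 t4]]].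
split; first exact: L2_lin.
exists (fun k x => z * Phi k x + Psi k x).
have sub_lin (x y x' y' : R[i]) :
    z * x + y - (z * x' + y') = z * (x - x') + (y - y') by ring.
split.
- by move=> k; exact: csmooth_lin.
- under eq_fun do under eq_integral do rewrite fn_lin sub_lin.
  apply: (L2cvg_lin mD z _ _ s2 t2) => k; apply: cmeasB;
    [exact: csmooth_cmeas|exact: L2_cmeas Lv|exact: csmooth_cmeas|exact: L2_cmeas Lv'].
- move=> i; under eq_fun do under eq_integral do
    rewrite pd_lin cpartial_lin// sub_lin.
  apply: (L2cvg_lin mD z _ _ (s3 i) (t3 i)) => k; apply: cmeasB;
    [exact: cpartial_cmeas|exact: L2_cmeas (Lpv i)
    |exact: cpartial_cmeas|exact: L2_cmeas (Lpv' i)].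
- under eq_fun do under eq_integral do rewrite sub_lin.
  apply: (L2cvg_lin mJ z _ _ s4 t4) => k; apply: cmeasB;
    [exact: csmooth_curve_cmeas|exact: L2_cmeas Lw
    |exact: csmooth_curve_cmeas|exact: L2_cmeas Lw'].
Qed.

Lemma open_itv_measurable (x y : R) :
  measurable ([set z | x < z < y] : set (measurableTypeR R)).
Proof.
rewrite (_ : [set z | _] = `]x, y[%classic); first exact: measurable_itv.
by apply/seteqP; split=> z; rewrite /= in_itv.
Qed.

Lemma period_measurable P : measurable (period P : set (measurableTypeR R)).
Proof. exact: open_itv_measurable. Qed.

Lemma H1qp_lin P a b (z : R[i]) v w : tame_profiles a b ->
  H1qp P a b v -> H1qp P a b w -> H1qp P a b (z *: v + w).
Proof.
move=> ab [Lv dv botv topv [x [x0 xL]]] [Lw dw botw topw [y [y0 yL]]].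
have mD := strip_measurable P ab; have [ca cb _] := ab.
have tl c (J : set (measurableTypeR R)) : measurable J -> continuous c -> forall f g,
    is_trace (strip P a b) v c J f -> is_trace (strip P a b) w c J g ->
    is_trace (strip P a b) (z *: v + w) c J (fun y => z * f y + g y).
  move=> mJ cc f g; apply: is_trace_lin => //.
    by move=> i; case: (dv i).
  by move=> i; case: (dw i).
have graph (f : R -> R) : continuous f -> continuous (fun x : R => (x, f x)).
  by move=> cf t; exact: (cvg_pair cvg_id (cf t)).
have vert (t : R) : continuous (fun y : R => (t, y)).
  by move=> s; exact: (cvg_pair (cvg_cst t) cvg_id).
split.
- exact: (L2_lin mD z Lv Lw).
- move=> i; have [[Lvi vi] [Lwi wi]] := (dv i, dw i); split.
    exact: (L2_lin mD z Lvi Lwi).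
  exact: (weak_partial_lin z ab Lv Lw Lvi Lwi vi wi).
- exact: (tl _ _ (period_measurable P) (graph _ ca) _ _ botv botw).
- exact: (tl _ _ (period_measurable P) (graph _ cb) _ _ topv topw).
- exists (fun t => z * x t + y t); split.
    exact: (tl _ _ (open_itv_measurable _ _) (vert 0) _ _ x0 y0).
  have := tl _ _ (open_itv_measurable _ _) (vert (Lam P)) _ _ xL yL.
  by congr is_trace; apply/funext => t; rewrite mulrDr mulrCA.
Qed.

End SobolevOnStrip.

(** * The derivative of a Lipschitz function is measurable *)

Lemma near_quotients (R : realType) (a b c d u e : R) :
  `|c - a| < e / 4 -> `|d - b| < e / 4 -> `|c - d| <= u -> u < e / 2 ->
  `|a - b| < e.
Proof.
rewrite !ltr_norml !ler_norml => /andP[? ?] /andP[? ?] /andP[? ?] ?.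
by apply/andP; split; lra.
Qed.

Lemma near_limit (R : realType) (l c d u : R) :
  `|l - c| < u / 2 -> `|l - d| < u / 2 -> `|c - d| <= u.
Proof.
rewrite !ltr_norml !ler_norml => /andP[? ?] /andP[? ?].
by apply/andP; split; lra.
Qed.

Section DerivativeOfLipschitzProfile.
Context {R : realType} (f : R -> R) (k : R).
Hypothesis f_lip : forall x y, `|f x - f y| <= k * `|x - y|.

Let quo (h x : R) : R := h^-1 *: (f (h + x) - f x).

Lemma lipschitz_continuous_fun : continuous f.
Proof.
move=> x; apply/cvgrPdist_le => e e0.
have k0 : 0 < `|k| + 1 by rewrite ltr_pwDr.
near=> y; rewrite (le_trans (f_lip _ _))//.
apply: (@le_trans _ _ ((`|k| + 1) * `|x - y|)).
  by rewrite ler_wpM2r// (le_trans (ler_norm _))// lerDl.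
rewrite mulrC -ler_pdivlMr//; near: y; apply: cvgr_dist_le => //.
by rewrite divr_gt0.
Unshelve. all: end_near. Qed.

Let quo_continuous h : continuous (quo h).
Proof.
move=> x; apply: cvgZr; apply: cvgB; last exact: lipschitz_continuous_fun.
apply: (@continuous_comp _ _ _ (fun y => h + y) f x);
  last exact: lipschitz_continuous_fun.
by apply: cvgD; [exact: cvg_cst|exact: cvg_id].
Qed.

Let quo_continuous_step x h : h != 0 -> {for h, continuous (quo ^~ x)}.
Proof.
move=> h0; apply: cvgZ; first exact: cvgV.
apply: cvgB; last exact: cvg_cst.
apply: (@continuous_comp _ _ _ (fun y => y + x) f h);
  last exact: lipschitz_continuous_fun.
by apply: cvgD; [exact: cvg_id|exact: cvg_cst].
Qed.

Let quo_le h x : h != 0 -> `|quo h x| <= k.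
Proof.
move=> h0; rewrite /quo normrZ normfV mulrC ler_pdivrMr ?normr_gt0//.
by rewrite (le_trans (f_lip _ _))// addrK.
Qed.

(** Cauchy's criterion for the difference quotients, with rational steps only so
  that it involves countably many measurable conditions on [x]. *)
Let cauchy_steps (m n : nat) (r s : rat) : set (measurableTypeR R) :=
  [set x | r != 0 -> s != 0 -> `|ratr r| < n.+1%:R^-1 :> R ->
    `|ratr s| < n.+1%:R^-1 :> R ->
    `|quo (ratr r) x - quo (ratr s) x| <= m.+1%:R^-1].

Let diff_set : set (measurableTypeR R) :=
  \bigcap_m \bigcup_n \bigcap_(r : rat) \bigcap_(s : rat) cauchy_steps m n r s.

Let cauchy_steps_measurable m n r s : measurable (cauchy_steps m n r s).
Proof.
rewrite /cauchy_steps.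
have mq h : measurable_fun setT (quo h : measurableTypeR R -> R).
  by apply: continuous_measurable_fun; exact: quo_continuous.
have mle : measurable [set x | `|quo (ratr r) x - quo (ratr s) x| <= m.+1%:R^-1 :> R].
  have mt : measurable [set true] by [].
  have mabs := measurableT_comp (@normr_measurable _ setT)
    (measurable_funB (mq (ratr r)) (mq (ratr s))).
  have mc : measurable_fun setT (fun _ : measurableTypeR R => m.+1%:R^-1 : R).
    exact: measurable_cst.
  have := measurable_fun_ler mabs mc measurableT mt.
  by rewrite setTI; congr measurable; apply/seteqP; split=> x.
have [c|nc] := pselect [/\ r != 0, s != 0, `|ratr r| < n.+1%:R^-1 :> R &
    `|ratr s| < n.+1%:R^-1 :> R].
  rewrite (_ : [set x | _] = [set x | `|quo (ratr r) x - quo (ratr s) x| <= m.+1%:R^-1])//.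
  by case: c => c1 c2 c3 c4; apply/seteqP; split=> x /=; [exact|].
rewrite (_ : [set x | _] = setT); first exact: measurableT.
by apply/seteqP; split=> x //= _ c1 c2 c3 c4; exfalso; apply: nc.
Qed.

Let diff_set_measurable : measurable diff_set.
Proof.
have bigcap_rat (F : rat -> set (measurableTypeR R)) :
    (forall r, measurable (F r)) -> measurable (\bigcap_r F r).
  move=> mF; rewrite -[X in measurable X]setCK setC_bigcap; apply: measurableC.
  by apply: bigcupT_measurable_rat => r; exact: measurableC.
apply: bigcapT_measurable => m; apply: bigcupT_measurable => n.
apply: (bigcap_rat) => r; apply: (bigcap_rat) => s.
exact: cauchy_steps_measurable.
Qed.

Let diff_setP x : diff_set x <-> cvg (quo ^~ x @ 0^').
Proof.
split=> [Ex|cq].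
  apply/cauchy_cvgP/cauchy_ballP => e e0.
  have [m me] : exists m, m.+1%:R^-1 < e / 2.
    have e2 : 0 < e / 2 by rewrite divr_gt0.
    by have [m _ /(_ m (leqnn m)) h] := near_infty_natSinv_lt (PosNum e2); exists m.
  have [n _ En] := Ex m I.
  have approx h : h != 0 -> `|h| < n.+1%:R^-1 -> exists2 r : rat,
      [/\ r != 0 & `|ratr r| < n.+1%:R^-1 :> R] & `|quo (ratr r) x - quo h x| < e / 4.
    move=> h0 hn; have e4 : 0 < e / 4 by rewrite divr_gt0.
    have near1 : \forall y \near h, `|quo y x - quo h x| < e / 4.
      have := @quo_continuous_step x h h0 => /cvgrPdist_lt/(_ _ e4).
      by apply: filterS => y; rewrite distrC.
    have near2 : \forall y \near h, `|y| < n.+1%:R^-1.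
      have hn' : 0 < n.+1%:R^-1 - `|h| by rewrite subr_gt0.
      have /cvgrPdist_lt/(_ _ hn') := @cvg_id _ (nbhs h).
      apply: filterS => y; rewrite ltrBrDl => hy; rewrite (le_lt_trans _ hy)//.
      by rewrite -[X in `|X| <= _](subKr h) (le_trans (ler_normB _ _)).
    have near3 : \forall y \near h, y != 0.
      have hn' : 0 < `|h| by rewrite normr_gt0.
      have /cvgrPdist_lt/(_ _ hn') := @cvg_id _ (nbhs h).
      by apply: filterS => y; apply: contraTneq => ->; rewrite subr0 ltxx.
    have [d /= d0 sub] := proj1 (nbhs_ballP _ _) (filterI near1 (filterI near2 near3)).
    have [r] : exists r, (ratr r : R) \in `](h - d), h[.
      by apply: rat_in_itvoo; rewrite ltrBlDr ltrDl.
    rewrite in_itv /= => /andP[r1 r2].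
    have [|q1 [q2 q3]] := sub (ratr r).
      by rewrite -ball_normE /= ltr_norml; apply/andP; split; lra.
    by exists r => //; split=> //; apply: contra_neq q3 => ->; rewrite rmorph0.
  have cauchy h1 h2 : h1 != 0 -> h2 != 0 -> `|h1| < n.+1%:R^-1 ->
      `|h2| < n.+1%:R^-1 -> `|quo h1 x - quo h2 x| < e.
    move=> h10 h20 h1n h2n.
    have [[r1 [r10 r1n] q1] [r2 [r20 r2n] q2]] := (approx _ h10 h1n, approx _ h20 h2n).
    have q12 := En r1 I r2 I r10 r20 r1n r2n.
    exact: (near_quotients q1 q2 q12 me).
  pose B : set R := [set z | exists2 h, h != 0 /\ `|h| < n.+1%:R^-1 & z = quo h x].
  exists (B, B) => /=.
    have BF : (quo^~ x @ 0^') B.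
      apply/nbhs_ballP; exists n.+1%:R^-1 => /=; first by rewrite invr_gt0.
      move=> h; rewrite -ball_normE /= sub0r normrN => hn h0.
      by exists h.
    by split.
  by move=> [_ _] /= [[h1 [? ?] ->] [h2 [? ?] ->]]; rewrite -ball_normE /=; exact: cauchy.
move=> m _.
have e0 : (0 : R) < m.+1%:R^-1 / 2 by rewrite divr_gt0// invr_gt0.
have /cvgrPdist_lt/(_ _ e0)/nbhs_ballP[d /= d0 sub] := cq.
have [n nd] : exists n, n.+1%:R^-1 < d.
  by have [n _ /(_ n (leqnn n)) h] := near_infty_natSinv_lt (PosNum d0); exists n.
exists n => // r _ s _ r0 s0 rn sn.
have close (t : rat) : t != 0 -> `|ratr t| < n.+1%:R^-1 :> R ->
    `|lim (quo^~ x @ 0^') - quo (ratr t) x| < m.+1%:R^-1 / 2.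
  move=> t0 tn; apply: sub; last by rewrite fmorph_eq0.
  by rewrite -ball_normE /= sub0r normrN (lt_trans tn).
exact: (near_limit (close _ r0 rn) (close _ s0 sn)).
Qed.

Let lim_diff x : ~ diff_set x -> derive1 f x = point.
Proof.
move=> nEx; rewrite /derive1 /lim /lim_in getPN// => l ql.
by apply: nEx; apply/diff_setP; apply/cvg_ex; exists l.
Qed.

Let inv_steps : (fun n => n.+1%:R^-1 : R) @ \oo --> (0 : R)^'.
Proof.
move=> A /nbhs_ballP[d /= d0 sub].
have [n _ nd] := near_infty_natSinv_lt (PosNum d0).
exists n => // m /= nm; apply: sub; last by rewrite invr_neq0.
by rewrite -ball_normE /= sub0r normrN ger0_norm ?invr_ge0//; exact: nd.
Qed.

(** The derivative is a limit of continuous difference quotients on the measurable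
  set where it exists, and has a constant default value elsewhere. The normal of
  [Gamma] is built from this derivative, so the interface integrals need this. *)
Lemma derive1_lipschitz_measurable :
  measurable_fun setT (derive1 f : measurableTypeR R -> R).
Proof.
rewrite -(setUv diff_set).
apply/measurable_funU => //; [exact: measurableC|split].
  apply: (@measurable_fun_cvg _ _ _ _ (fun n => quo n.+1%:R^-1)).
    move=> n; apply: measurable_funTS.
    by apply: continuous_measurable_fun; exact: quo_continuous.
  by move=> x /diff_setP cq; apply: cvg_comp cq; exact: inv_steps.
apply: (eq_measurable_fun (fun=> point)).
  by move=> x; rewrite inE => nEx; rewrite lim_diff.
exact: measurable_cst.
Qed.

Lemma derive1_lipschitz_le x : `|derive1 f x| <= Num.max k `|point : R|.
Proof.
rewrite le_max; have [Ex|nEx] := pselect (diff_set x); last first.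
  by rewrite lim_diff// lexx orbT.
apply/orP; left; move/diff_setP : Ex => cq.
have cn : `|quo n.+1%:R^-1 x| @[n --> \oo] --> `|derive1 f x|.
  by apply: cvg_norm; apply: cvg_comp cq; exact: inv_steps.
by apply: (cvgr_to_le cn); apply: nearW => n /=; rewrite quo_le.
Qed.

End DerivativeOfLipschitzProfile.

(** * Duality pairings as Fourier series *)

Section SymmetricSeries.
Context {R : realType}.

Definition symsum (V : nmodType) (a : int -> V) (N : nat) : V :=
  \sum_(k < N.*2.+1) a (k%:Z - N%:Z).

Lemma symsumS (V : nmodType) (a : int -> V) N :
  symsum a N.+1 = a (- N.+1%:Z) + symsum a N + a N.+1%:Z.
Proof.
rewrite /symsum doubleS big_ord_recr big_ord_recl /= sub0r.
congr (_ + _ + a _); last by rewrite -addnn; lia.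
by apply: eq_bigr => k _; congr a; rewrite /bump /=; lia.
Qed.

Definition symsum_bounded (b : int -> R) : Prop :=
  exists M, forall N, symsum b N <= M.

Definition abs_summable (a : int -> R[i]) : Prop :=
  symsum_bounded (fun n => cabs (a n)).

Lemma symsum_lin (c : R) (a b : int -> R) N :
  symsum (fun n => c * a n + b n) N = c * symsum a N + symsum b N.
Proof. by rewrite /symsum big_split mulr_sumr. Qed.

Lemma le_symsum (a b : int -> R) N : (forall n, a n <= b n) ->
  symsum a N <= symsum b N.
Proof. by move=> ab; apply: ler_sum => k _. Qed.

Lemma symsum_bounded_le (a b : int -> R) : (forall n, a n <= b n) ->
  symsum_bounded b -> symsum_bounded a.
Proof.
by move=> ab [M bM]; exists M => N; rewrite (le_trans (le_symsum _ ab)).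
Qed.

Lemma symsum_bounded_lin (c : R) (a b : int -> R) : 0 <= c ->
  symsum_bounded a -> symsum_bounded b ->
  symsum_bounded (fun n => c * a n + b n).
Proof.
move=> c0 [M aM] [M' bM']; exists (c * M + M') => N.
by rewrite symsum_lin lerD// ler_wpM2l.
Qed.

Lemma symsum_nonneg_cvg (b : int -> R) : (forall n, 0 <= b n) ->
  symsum_bounded b -> cvgn (symsum b).
Proof.
move=> b0 [M bM]; apply: nondecreasing_is_cvgn; last first.
  by exists M => _ [N _ <-].
apply/nondecreasing_seqP => N; rewrite symsumS.
by have := b0 (- N.+1%:Z); have := b0 N.+1%:Z; lra.
Qed.

(** Both [u + b] and [b] are nonnegative, so that their symmetric sums are monotone
  and bounded; [u] is their difference. *)
Lemma symsum_cvg (u b : int -> R) : (forall n, `|u n| <= b n) ->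
  symsum_bounded b -> cvgn (symsum u).
Proof.
move=> ub bb; have b0 n : 0 <= b n by rewrite (le_trans _ (ub n)).
have cb := symsum_nonneg_cvg b0 bb.
have cub : cvgn (symsum (fun n => 1 * u n + b n)).
  apply: symsum_nonneg_cvg => [n|].
    by have := ub n; rewrite ler_norml mul1r; lra.
  apply: (@symsum_bounded_le _ (fun n => 1 * b n + b n)).
    by move=> n; rewrite !mul1r lerD2r (le_trans (ler_norm _)).
  exact: symsum_bounded_lin.
rewrite (_ : symsum u = symsum (fun n => 1 * u n + b n) \- symsum b).
  exact: is_cvgB.
by apply/funext => N; rewrite /= symsum_lin mul1r addrK.
Qed.

Lemma Re_symsum (a : int -> R[i]) N :
  complex.Re (symsum a N) = symsum (fun n => complex.Re (a n)) N.
Proof. by rewrite /symsum raddf_sum. Qed.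

Lemma Im_symsum (a : int -> R[i]) N :
  complex.Im (symsum a N) = symsum (fun n => complex.Im (a n)) N.
Proof. by rewrite /symsum raddf_sum. Qed.

Lemma csumZ_symsum (a : int -> R[i]) : csumZ a =
  (limn (symsum (fun n => complex.Re (a n))) +i*
   limn (symsum (fun n => complex.Im (a n))))%C.
Proof.
rewrite /csumZ; congr (limn _ +i* limn _)%C.
- by apply/funext => N; exact: Re_symsum.
- by apply/funext => N; exact: Im_symsum.
Qed.

Lemma csumZ_lin (c : R[i]) (a b : int -> R[i]) :
  abs_summable a -> abs_summable b ->
  csumZ (fun n => c * a n + b n) = c * csumZ a + csumZ b.
Proof.
move=> sa sb.
have aR := symsum_cvg (fun n => ler_Re_cabs (a n)) sa.
have aI := symsum_cvg (fun n => ler_Im_cabs (a n)) sa.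
have bR := symsum_cvg (fun n => ler_Re_cabs (b n)) sb.
have bI := symsum_cvg (fun n => ler_Im_cabs (b n)) sb.
rewrite !csumZ_symsum [RHS]complex_eta Re_addc Im_addc Re_mulc Im_mulc /=.
congr (_ +i* _)%C.
- rewrite (_ : symsum _ = (complex.Re c \*: symsum (fun n => complex.Re (a n)) \-
      complex.Im c \*: symsum (fun n => complex.Im (a n))) \+
      symsum (fun n => complex.Re (b n))).
    apply/cvg_lim => //; apply: cvgD => //; apply: cvgB; exact: cvgZr.
  apply/funext => N; rewrite /symsum /= !scaler_sumr -sumrB -big_split /=.
  by apply: eq_bigr => k _; rewrite Re_addc Re_mulc.
- rewrite (_ : symsum _ = (complex.Re c \*: symsum (fun n => complex.Im (a n)) \+
      complex.Im c \*: symsum (fun n => complex.Re (a n))) \+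
      symsum (fun n => complex.Im (b n))).
    apply/cvg_lim => //; apply: cvgD => //; apply: cvgD; exact: cvgZr.
  apply/funext => N; rewrite /symsum /= !scaler_sumr -!big_split /=.
  by apply: eq_bigr => k _; rewrite Im_addc Im_mulc.
Qed.

Lemma symsum_bounded_esum (b : int -> R) : (forall n, 0 <= b n) ->
  (\esum_(n in [set: int]) (b n)%:E < +oo)%E -> symsum_bounded b.
Proof.
move=> b0 fin.
have e0 : (0 <= \esum_(n in [set: int]) (b n)%:E)%E.
  by apply: esum_ge0 => n _; rewrite lee_fin.
exists (fine (\esum_(n in [set: int]) (b n)%:E)) => N.
rewrite -lee_fin fineK ?ge0_fin_numE//.
pose r := [seq (nat_of_ord k)%:Z - N%:Z | k : 'I_(N.*2.+1)].
have ur : uniq r.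
  rewrite map_inj_uniq ?enum_uniq// => i j /eqP.
  by rewrite subr_eq subrK => /eqP [] /ord_inj.
apply: esum_ge; exists [set` r]; first by split => //; exact: finite_seq.
rewrite -fsbig_seq// /symsum big_map big_enum /= -sumEFin.
exact: lexx.
Qed.

End SymmetricSeries.

Section BoundaryPairings.
Context {R : realType} (P : setting R).
Hypothesis LP : 0 < Lam P.
Implicit Types (t s w : R -> R[i]) (m : int -> R[i]).

(** Traces of class [H^{1/2}]. *)
Definition half_trace w : Prop :=
  L2 (leb1 R) (period P) w /\ (hhalf P w < +oo)%E.

(** The weight of the [H^{1/2}] norm. *)
Definition growth (n : int) : R := Num.sqrt (1 + alphan P n ^+ 2).

(** Fourier multipliers of order one, hence bounded from [H^{1/2}] to
  [H^{-1/2}]. *)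
Definition order_one m : Prop := exists C, forall n, cabs (m n) <= C * growth n.

Lemma growth_ge1 n : 1 <= growth n.
Proof. by rewrite -[X in X <= _]sqrtr1 ler_wsqrtr// lerDl sqr_ge0. Qed.

Lemma growth_ge0 n : 0 <= growth n.
Proof. exact: sqrtr_ge0. Qed.

Lemma alphan_le_growth n : `|alphan P n| <= growth n.
Proof. by rewrite -sqrtr_sqr ler_wsqrtr// lerDr. Qed.

Lemma fcoef_lin (c : R[i]) t s n :
  L2 (leb1 R) (period P) t -> L2 (leb1 R) (period P) s ->
  fcoef P (fun x => c * t x + s x) n = c * fcoef P t n + fcoef P s n.
Proof.
move=> Lt Ls; have mp := period_measurable P.
have fp : (leb1 R (period P) < +oo)%E.
  rewrite (_ : period P = `]0, Lam P[%classic); last first.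
    by apply/seteqP; split=> z; rewrite /= in_itv.
  rewrite /leb1 lebesgue_measure_itv /= lte_fin.
  by case: ifPn => _; rewrite ?ltry// -EFinB ltry.
pose e x : R[i] := cexp (0 +i* (- (alphan P n * x)))%C.
have Le : L2 (leb1 R) (period P) e.
  have ce : cmeas (period P) e.
    have mcos : measurable_fun setT
        (fun x : measurableTypeR R => cos (- (alphan P n * x))).
      apply: continuous_measurable_fun => x.
      apply: continuous_comp; last exact: continuous_cos.
      by apply: cvgN; apply: cvgM; [exact: cvg_cst|exact: cvg_id].
    have msin : measurable_fun setT
        (fun x : measurableTypeR R => sin (- (alphan P n * x))).
      apply: continuous_measurable_fun => x.
      apply: continuous_comp; last exact: continuous_sin.
      by apply: cvgN; apply: cvgM; [exact: cvg_cst|exact: cvg_id].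
    split; rewrite /e /cexp /= expR0; apply: measurable_funTS.
    - by under eq_fun do rewrite mul1r mul0r subr0.
    - by under eq_fun do rewrite mul1r mul0r addr0.
  apply: (@bounded_L2 _ _ _ (leb1 R) _ mp 1) => // x _.
  by rewrite /e /cexp cabsM cabs_real /= expR0 normr1 mul1r /cabs /= cos2Dsin2 sqrtr1.
rewrite /fcoef -!/(e _) [RHS]addrC mulrCA addrC -mulrDr; congr (_ * _).
rewrite -cint_lin//; try exact: L2M.
by apply: eq_cint => x _; rewrite mulrDl mulrA.
Qed.

Lemma half_trace_symsum w : half_trace w ->
  symsum_bounded (fun n => growth n * cabs (fcoef P w n) ^+ 2).
Proof.
move=> [_]; rewrite /hhalf /hhalf2 => fin.
have nn n : 0 <= growth n * cabs (fcoef P w n) ^+ 2.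
  by rewrite mulr_ge0 ?sqr_ge0 ?growth_ge0.
apply: symsum_bounded_esum => //; rewrite ltey; apply: contraTneq fin => ->.
by rewrite gt0_muley ?lte_fin// -leNgt.
Qed.

(** The geometric mean of the two [H^{1/2}] sums: this convergence is what makes
  the symmetric partial sums in the duality pairing additive. *)
Lemma order_one_summable m t w : order_one m -> half_trace t -> half_trace w ->
  abs_summable (fun n => m n * fcoef P t n * (fcoef P w n)^*%C).
Proof.
move=> [C mC] /half_trace_symsum st /half_trace_symsum sw.
apply: (@symsum_bounded_le _ _ (fun n => `|C| * (1 * (growth n * cabs (fcoef P t n) ^+ 2) +
    growth n * cabs (fcoef P w n) ^+ 2) + 0)) => [n|]; last first.
  apply: symsum_bounded_lin => //; first exact: symsum_bounded_lin.
  by exists 0 => N; rewrite /symsum big1.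
rewrite addr0 mul1r -mulrDr [leRHS]mulrA -[X in cabs X]mulrA cabsM ler_pM ?cabs_ge0//.
  by rewrite (le_trans (mC n))// ler_wpM2r ?growth_ge0// ler_norm.
by rewrite (le_trans (cabs_mul_le _ _))// cabsJ.
Qed.

Definition pairing m t w : R[i] := dual P (fun n => m n * fcoef P t n) w.

Lemma pairing_linl (c : R[i]) m t s w :
  order_one m -> half_trace t -> half_trace s -> half_trace w ->
  pairing m (fun x => c * t x + s x) w = c * pairing m t w + pairing m s w.
Proof.
move=> om ht hs hw; rewrite /pairing /dual mulrCA -mulrDr; congr (_ * _).
rewrite -csumZ_lin; try exact: order_one_summable.
congr csumZ; apply/funext => n.
by rewrite fcoef_lin; [ring|exact: ht.1|exact: hs.1].
Qed.

Lemma pairing_linr (c : R[i]) m t w s :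
  order_one m -> half_trace t -> half_trace w -> half_trace s ->
  pairing m t (fun x => c * w x + s x) = c^*%C * pairing m t w + pairing m t s.
Proof.
move=> om ht hw hs; rewrite /pairing /dual mulrCA -mulrDr; congr (_ * _).
rewrite -csumZ_lin; try exact: order_one_summable.
congr csumZ; apply/funext => n.
rewrite fcoef_lin; [|exact: hw.1|exact: hs.1].
by rewrite rmorphD rmorphM /=; ring.
Qed.

(** Only finitely many frequencies are small, so the growth condition need only
  be checked for large ones. *)
Lemma order_one_eventually m (C K : R) : 0 <= C ->
  (forall n, K < `|alphan P n| -> cabs (m n) <= C * growth n) -> order_one m.
Proof.
move=> C0 mC.
pose t := (K + `|alpha P|) * Lam P / (2 * pi).
pose N := (Num.truncn `|t|).+1.
pose M := symsum (fun n => cabs (m n)) N.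
have small n : `|alphan P n| <= K -> (`|n| <= N)%N.
  move=> nK; rewrite -(ler_nat R); apply: ltW.
  apply: le_lt_trans (truncnS_gt _); apply: le_trans (ler_norm t).
  rewrite /t ler_pdivlMr ?mulr_gt0 ?pi_gt0// -ler_pdivrMr//.
  have -> : `|n|%N%:R * (2 * pi) / Lam P = `|2 * pi * n%:~R / Lam P|.
    rewrite natr_absz intr_norm normf_div !normrM (gtr0_norm LP).
    by rewrite (gtr0_norm (pi_gt0 R)) (ger0_norm (ler0n R 2)) [_ * (2 * pi)]mulrC.
  rewrite -[X in `|X|](addKr (alpha P)) addrC (le_trans (ler_normB _ _))//.
  by rewrite lerD2r.
exists (C + M) => n.
have M0 : 0 <= M by apply: sumr_ge0 => k _; exact: cabs_ge0.
have [nK|Kn] := leP `|alphan P n| K; last first.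
  by rewrite (le_trans (mC _ Kn))// ler_wpM2r ?growth_ge0// lerDl.
have nN := small _ nK.
have kN : (absz (n + N%:Z)%R < N.*2.+1)%N by lia.
apply: (@le_trans _ _ M); last first.
  rewrite -[X in X <= _]mulr1 ler_pM ?growth_ge1//.
  by rewrite lerDr.
rewrite /M /symsum (bigD1 (Ordinal kN))//=.
have -> : (absz (n + N%:Z)%R)%:Z - N%:Z = n by lia.
by rewrite lerDl sumr_ge0// => k _; exact: cabs_ge0.
Qed.

End BoundaryPairings.

(** * The stretching function and the growth of the Fourier multipliers *)

Section LayerProfile.
Context {R : realType} (P : setting R).
Hypothesis hP : standing P.

Lemma height_lt : height2 P < height1 P.
Proof. by have /andP[a b] := surf_between hP 0; exact: lt_trans a b. Qed.

Lemma spml_cmeas : cmeas [set: measurableTypeR R] (spml P).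
Proof.
have mpow (f : measurableTypeR R -> R) (s : R[i]) : measurable_fun setT f ->
    cmeas setT (fun y => 1 + s * (f y `^ expo P)%:C%C).
  move=> mf; apply: cmeasD; first exact: cmeas_cst.
  apply: cmeasM; first exact: cmeas_cst.
  apply: (@cmeas_real _ _ _ _ (fun y => f y `^ expo P)).
  exact: (measurableT_comp (@measurable_powR R (expo P)) mf).
have mid : measurable_fun setT (fun y : measurableTypeR R => y : R).
  exact: measurable_id.
have mc (c : R) : measurable_fun setT (fun _ : measurableTypeR R => c).
  exact: measurable_cst.
have [m1r m1i] := mpow (fun y => (y - height1 P) / delta1 P) (sigma1 P)
  (measurable_funM (measurable_funB mid (mc _)) (mc _)).
have [m2r m2i] := mpow (fun y => (height2 P - y) / delta2 P) (sigma2 P)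
  (measurable_funM (measurable_funB (mc _) mid) (mc _)).
have b1 := measurable_fun_ler (mc (height1 P)) mid.
have b2 := measurable_fun_ler mid (mc (height2 P)).
split.
- rewrite (_ : (fun x => _) = fun y => if height1 P <= y
      then complex.Re (1 + sigma1 P * (((y - height1 P) / delta1 P) `^ expo P)%:C%C)
      else if y <= height2 P
      then complex.Re (1 + sigma2 P * (((height2 P - y) / delta2 P) `^ expo P)%:C%C)
      else 1).
    by apply: measurable_fun_ifT => //; apply: measurable_fun_ifT.
  by apply/funext => y; rewrite /spml; case: ifP => // _; case: ifP.
- rewrite (_ : (fun x => _) = fun y => if height1 P <= y
      then complex.Im (1 + sigma1 P * (((y - height1 P) / delta1 P) `^ expo P)%:C%C)
      else if y <= height2 P
      then complex.Im (1 + sigma2 P * (((height2 P - y) / delta2 P) `^ expo P)%:C%C)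
      else 0).
    by apply: measurable_fun_ifT => //; apply: measurable_fun_ifT.
  by apply/funext => y; rewrite /spml; case: ifP => // _; case: ifP.
Qed.

Lemma spml_bounded y : height2 P - delta2 P <= y <= height1 P + delta1 P ->
  cabs (spml P y) <= 1 + cabs (sigma1 P) + cabs (sigma2 P).
Proof.
move=> /andP[y1 y2]; have [d1 d2] := delta_gt0 hP.
have t0 : 0 <= expo P by rewrite (le_trans _ (expo_ge1 hP)).
have pow1 (x : R) : 0 <= x <= 1 -> cabs (x `^ expo P)%:C%C <= 1.
  move=> /andP[x0 x1]; rewrite cabs_real ger0_norm ?powR_ge0//.
  by have := @ge0_ler_powR _ _ t0 x 1; rewrite powR1 => ->//; rewrite nnegrE.
have bnd (s : R[i]) x : 0 <= x <= 1 -> cabs (1 + s * (x `^ expo P)%:C%C) <= 1 + cabs s.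
  move=> x01; rewrite (le_trans (cabsD _ _))// lerD//.
    by rewrite cabs_real normr1.
  by rewrite cabsM ler_piMr ?cabs_ge0 ?pow1.
have c1 := cabs_ge0 (sigma1 P); have c2 := cabs_ge0 (sigma2 P).
rewrite /spml; case: ifPn => [h1|_].
  apply: (le_trans (bnd _ _ _)); last by rewrite lerDl.
  apply/andP; split; first by rewrite divr_ge0 ?subr_ge0 ?(ltW d1).
  by rewrite ler_pdivrMr// mul1r lerBlDl.
case: ifPn => [h2|_].
  apply: (le_trans (bnd _ _ _)); last by rewrite -addrA lerD2l lerDr.
  apply/andP; split; first by rewrite divr_ge0 ?subr_ge0 ?(ltW d2).
  by rewrite ler_pdivrMr// mul1r lerBlDr -lerBlDl.
by rewrite cabs_real normr1 -addrA lerDl addr_ge0.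
Qed.

Lemma cabs_spml_inv y : cabs (spml P y)^-1 <= 1.
Proof.
have s1 : 1 <= cabs (spml P y).
  by rewrite (le_trans (spml_Re hP y))// (le_trans (ler_norm _))// ler_Re_cabs.
by rewrite cabsV invf_le1// (lt_le_trans _ s1).
Qed.

Lemma spml_neq0 y : spml P y != 0.
Proof.
by apply: contraTneq (spml_Re hP y) => ->; rewrite /= -ltNge ltr01.
Qed.

Lemma spml_inv_cmeas : cmeas [set: measurableTypeR R] (fun y => (spml P y)^-1).
Proof.
have ms := spml_cmeas.
rewrite (_ : (fun y => _) =
    fun y => (spml P y)^*%C * ((cabs (spml P y) ^+ 2) `^ (-1))%:C%C).
  apply: cmeasM; first exact: cmeasJ.
  apply: cmeas_real; apply: (@measurableT_comp _ _ _ _ _ _ (@powR R ^~ (-1))).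
    exact: measurable_powR.
  exact: cmeas_sqr.
apply/funext => y; rewrite powR_inv1 ?sqr_ge0// sqr_cabs.
have s0 := spml_neq0 y; apply: (mulfI s0); rewrite divff//.
have : complex.Re (spml P y) ^+ 2 + complex.Im (spml P y) ^+ 2 != 0.
  have r1 := spml_Re hP y; rewrite gt_eqF//.
  by have := sqr_ge0 (complex.Im (spml P y)); nra.
case: (spml P y) {s0} => a b /= ab; simpc.
by congr (_ +i* _)%C; field.
Qed.

(** The real part of [s] is at least one across a layer of thickness [delta1]. *)
Lemma Re_eta1_gt0 : 0 < complex.Re (eta1 P).
Proof.
have [d1 _] := delta_gt0 hP; rewrite /eta1 /cint /=.
set D := [set y | _].
have mD : measurable (D : set (measurableTypeR R)) := open_itv_measurable _ _.
have DE : D = `]height1 P, height1 P + delta1 P[%classic.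
  by apply/seteqP; split=> z; rewrite /= in_itv.
have muD : leb1 R D = (delta1 P)%:E.
  by rewrite DE /leb1 lebesgue_measure_itv /= lte_fin ltrDl d1 -EFinB addrAC subrr add0r.
have int_bounded (f : measurableTypeR R -> R) M : measurable_fun setT f ->
    (forall y, D y -> `|f y| <= M) -> (leb1 R).-integrable D (EFin \o f).
  move=> mf fM; apply: measurable_bounded_integrable => //.
  - by have : (leb1 R D < +oo)%E by rewrite muD ltry.
  - exact: measurable_funTS.
  - exists M; split; first exact: num_real.
    by move=> M' MM' y Dy; exact: le_trans (fM _ Dy) (ltW MM').
have : (\int[leb1 R]_(y in D) (cst 1 y))%R <=
    Rintegral (leb1 R) D (fun y => complex.Re (spml P y)).
  apply: le_Rintegral => //.
  - by apply: (int_bounded _ 1) => [|y _]; [exact: measurable_cst|rewrite normr1].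
  - apply: (int_bounded _ (1 + cabs (sigma1 P) + cabs (sigma2 P))).
      exact: spml_cmeas.1.
    move=> y /andP[y1 y2]; rewrite (le_trans (ler_Re_cabs _))// spml_bounded//.
    have [_ d2] := delta_gt0 hP; have := height_lt.
    by move=> h21; apply/andP; split; lra.
  - by move=> y _; exact: spml_Re.
rewrite Rintegral_cst// mul1r (_ : fine _ = delta1 P);
  last by rewrite -[RHS]/(fine (delta1 P)%:E) -muD.
exact: lt_le_trans.
Qed.

Lemma eta_ge0 : [/\ 0 <= complex.Re (eta1 P), 0 <= complex.Im (eta1 P),
  0 <= complex.Re (eta2 P) & 0 <= complex.Im (eta2 P)].
Proof.
have re y : 0 <= complex.Re (spml P y) by rewrite (le_trans _ (spml_Re hP y)).
split; apply: Rintegral_ge0 => y //= Dy; apply: ltW; apply: spml_Im => //.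
- by left.
- by right.
Qed.

Let decay_ge0 (c x y : R) : 0 <= c -> 0 <= x -> 0 <= y ->
  0 <= c * x / (expR (y * x) - 1).
Proof.
move=> c0 x0 y0; rewrite divr_ge0 ?mulr_ge0// subr_ge0 -expR0 ler_expR.
exact: mulr_ge0.
Qed.

Lemma minTheta_ge0 k S : 0 <= minTheta P k S.
Proof.
rewrite /minTheta; have [->|/set0P[n Sn]] := eqVneq S set0.
  by rewrite image_set0 inf0.
apply: lb_le_inf; first by exists (Theta P k n), n.
by move=> _ [m _ <-]; exact: sqrtr_ge0.
Qed.

Let omit_empty_ge0 (S : set int) (x : R) : 0 <= x -> 0 <= omit_empty S x.
Proof. by rewrite /omit_empty; case: ifP. Qed.

Lemma F1_ge0 : 0 <= F1 P.
Proof.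
have [r1 i1 _ _] := eta_ge0.
rewrite /F1 le_max; apply/orP; left; apply: omit_empty_ge0.
apply: decay_ge0; rewrite ?minTheta_ge0//.
exact: mulr_ge0.
Qed.

Lemma F2_ge0 : 0 <= F2 P.
Proof.
have [_ _ r2 i2] := eta_ge0; have [_ rho0 om0 _] := const_gt0 hP.
rewrite /F2; apply: mulr_ge0; [apply: mulr_ge0|].
- by rewrite divr_ge0 ?exprn_even_ge0// mulr_ge0 ?mulr_ge0 ?sqr_ge0// ltW.
- rewrite le_max; apply/orP; left; rewrite /F2_decay le_max; apply/orP; left.
  apply: omit_empty_ge0; rewrite mulrAC -[X in X / _]mul1r.
  by apply: decay_ge0; rewrite ?minTheta_ge0// mulr_ge0// invr_ge0.
- rewrite le_max; apply/orP; left; rewrite mulr_ge0// /kappa2 mulr_ge0 ?sqrtr_ge0//.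
  exact: ltW.
Qed.

End LayerProfile.

Section Multipliers.
Context {R : realType} (P : setting R).
Hypothesis hP : standing P.

Lemma betan_evanescent k n : k < `|alphan P n| ->
  betan P k n = (0 +i* Num.sqrt (alphan P n ^+ 2 - k ^+ 2))%C.
Proof. by move=> kn; rewrite /betan ltNge (ltW kn). Qed.

Lemma sqrt_le_growth k n : Num.sqrt (alphan P n ^+ 2 - k ^+ 2) <= growth P n.
Proof. by rewrite ler_wsqrtr//; have := sqr_ge0 k; lra. Qed.

Lemma cabs_iC : cabs (iC R) = 1.
Proof. by rewrite /iC cabs_imag normr1. Qed.

Lemma Tplus_order_one : order_one P (fun n => iC R * betan P (kappa P) n).
Proof.
have [_ _ _ k0] := const_gt0 hP.
apply: (order_one_eventually (Lam_gt0 hP) (C := 1) (K := kappa P)) => // n kn.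
rewrite betan_evanescent// cabsM cabs_iC !mul1r cabs_imag.
by rewrite ger0_norm ?sqrtr_ge0// sqrt_le_growth.
Qed.

Lemma cabs_cexp (z : R[i]) : cabs (cexp z) = expR (complex.Re z).
Proof.
rewrite /cexp cabsM cabs_real ger0_norm ?expR_ge0//.
by rewrite /cabs /= cos2Dsin2 sqrtr1 mulr1.
Qed.

(** When [Re z >= c > 0], the modulus of [e^{-z}] is smaller than that of [e^z] by
  the factor [e^{-2c}], so the denominator cannot be small. *)
Lemma cabs_ccoth (c : R) (z : R[i]) : 0 < c -> c <= complex.Re z ->
  cabs (ccoth z) <= 2 / (1 - expR (- (2 * c))).
Proof.
move=> c0 cz; set q := expR _; set E := expR (complex.Re z).
have q1 : q < 1 by rewrite /q expR_lt1 oppr_lt0 mulr_gt0.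
have q0 : 0 < q := expR_gt0 _; have E0 : 0 < E := expR_gt0 _.
have zE : cabs (cexp z) = E by rewrite cabs_cexp.
have zqE : cabs (cexp (- z)) <= q * E.
  rewrite cabs_cexp raddfN /q /E -expRD ler_expR /=; lra.
have num : cabs (cexp z + cexp (- z)) <= 2 * E.
  rewrite (le_trans (cabsD _ _))// zE; nra.
have den : (1 - q) * E <= cabs (cexp z - cexp (- z)).
  have := cabsD (cexp z - cexp (- z)) (cexp (- z)); rewrite subrK zE; lra.
have den0 : 0 < (1 - q) * E by rewrite mulr_gt0// subr_gt0.
rewrite /ccoth cabsM cabsV ler_pdivrMr; last exact: lt_le_trans den.
apply: (le_trans num); rewrite -mulrA ler_wpM2l//.
by rewrite ler_pdivlMl ?subr_gt0.
Qed.

(** The cut at [kappa + 1] keeps [Theta_n >= 1], so that the argument of [coth] has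
  real part at least [Re eta_1 > 0]. *)
Lemma TplusPML_order_one : order_one P (fun n => iC R * betan P (kappa P) n *
  ccoth (- (iC R * betan P (kappa P) n * eta1 P))).
Proof.
have [_ _ _ k0] := const_gt0 hP; have c0 := Re_eta1_gt0 hP.
set c := complex.Re _ in c0.
have C0 : 0 <= 2 / (1 - expR (- (2 * c))).
  by rewrite divr_ge0// subr_ge0 -expR0 ler_expR oppr_le0 mulr_ge0// ltW.
apply: (order_one_eventually (Lam_gt0 hP) (K := kappa P + 1) C0) => n kn.
have kn' : kappa P < `|alphan P n| by rewrite (lt_trans _ kn)// ltrDl.
rewrite betan_evanescent//; set T := Num.sqrt _.
have T1 : 1 <= T.
  rewrite -[X in X <= _]sqrtr1 ler_wsqrtr//.
  have : (kappa P + 1) ^+ 2 <= `|alphan P n| ^+ 2.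
    by rewrite ler_pXn2r ?nnegrE// ?(ltW kn)// addr_ge0// ltW.
  by rewrite real_normK ?num_real// sqrrD1; nra.
have -> : - (iC R * (0 +i* T)%C * eta1 P) = T%:C%C * eta1 P.
  by rewrite /iC; case: (eta1 P) => a b; simpc; congr (_ +i* _)%C; ring.
rewrite cabsM cabsM cabs_iC mul1r cabs_imag (ger0_norm (sqrtr_ge0 _)) mulrC.
apply: ler_pM; rewrite ?cabs_ge0 ?sqrtr_ge0 ?sqrt_le_growth//.
apply: cabs_ccoth => //; rewrite Re_mulc /= mul0r subr0.
by rewrite -[X in X <= _]mul1r ler_wpM2r// ltW.
Qed.

Lemma kappa12_gt0 : 0 < kappa1 P /\ 0 < kappa2 P.
Proof.
have [_ rho0 om0 _] := const_gt0 hP; have [mu0 lm0] := lame_pos hP.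
split; rewrite mulr_gt0// sqrtr_gt0 divr_gt0//.
by rewrite (_ : _ + _ = mu P + (lam P + mu P)); [exact: addr_gt0|ring].
Qed.

(** The entries of [W_n] grow linearly because [X_n] stays away from zero:
  for large [n], [X_n = a^2 - sqrt (a^2 - k1^2) sqrt (a^2 - k2^2)] is at least
  [(k1^2 + k2^2) / 2] by the inequality of arithmetic and geometric means. *)
Lemma Wn_order_one i j : order_one P (fun n => Wn P n i j).
Proof.
have [k10 k20] := kappa12_gt0; have [_ rho0 om0 _] := const_gt0 hP.
have [mu0 _] := lame_pos hP.
have [w wE] : exists w, w = omega P ^+ 2 * rho P by eexists.
have w0 : 0 < w by rewrite wE mulr_gt0// exprn_gt0.
pose x0 := (kappa1 P ^+ 2 + kappa2 P ^+ 2) / 2.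
have x00 : 0 < x0 by rewrite divr_gt0// addr_gt0// exprn_gt0.
apply: (order_one_eventually (Lam_gt0 hP) (C := 2 * mu P + w / x0)
  (K := kappa1 P + kappa2 P)).
  apply: addr_ge0; first exact: mulr_ge0 (ler0n _ _) (ltW mu0).
  exact: divr_ge0 (ltW w0) (ltW x00).
move=> n Kn.
have n1 : kappa1 P < `|alphan P n| by rewrite (lt_trans _ Kn)// ltrDl.
have n2 : kappa2 P < `|alphan P n| by rewrite (lt_trans _ Kn)// ltrDr.
have sq k : 0 < k -> k < `|alphan P n| -> 0 <= alphan P n ^+ 2 - k ^+ 2.
  move=> k0 kn; rewrite subr_ge0 -[leRHS]real_normK ?num_real//.
  by rewrite ler_pXn2r ?nnegrE// ltW.
pose T1 := Num.sqrt (alphan P n ^+ 2 - kappa1 P ^+ 2).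
pose T2 := Num.sqrt (alphan P n ^+ 2 - kappa2 P ^+ 2).
have b1 : betan P (kappa1 P) n = (0 +i* T1)%C by rewrite betan_evanescent.
have b2 : betan P (kappa2 P) n = (0 +i* T2)%C by rewrite betan_evanescent.
have [X [XE x0X]] : exists X, Xn P n = X%:C%C /\ x0 <= X.
  exists (alphan P n ^+ 2 - T1 * T2); split.
    by rewrite /Xn b1 b2; simpc; congr (_ +i* _)%C; ring.
  have t1 : T1 ^+ 2 = alphan P n ^+ 2 - kappa1 P ^+ 2 by rewrite sqr_sqrtr// sq.
  have t2 : T2 ^+ 2 = alphan P n ^+ 2 - kappa2 P ^+ 2 by rewrite sqr_sqrtr// sq.
  by rewrite /x0; have := sqr_ge0 (T1 - T2); rewrite sqrrB; nra.
have X0 : 0 < X := lt_le_trans x00 x0X.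
have g0 := growth_ge0 P n; have ag := alphan_le_growth P n.
have entry (e : R[i]) : cabs e <= (2 * mu P * X + w) * growth P n ->
    cabs (iC R / Xn P n * e) <= (2 * mu P + w / x0) * growth P n.
  move=> eb; rewrite cabsM cabsM cabs_iC mul1r XE cabsV cabs_real gtr0_norm//.
  rewrite ler_pdivrMl//; apply: (le_trans eb); rewrite mulrA ler_wpM2r//.
  rewrite mulrDr [X * _]mulrC lerD2l mulrC -mulrA ler_peMr ?(ltW w0)//.
  by rewrite ler_pdivlMl// mulr1.
have diag (T : R) : T <= growth P n -> 0 <= T ->
    cabs ((w)%:C%C * (0 +i* T)%C) <= (2 * mu P * X + w) * growth P n.
  move=> Tg T0; rewrite cabsM cabs_real cabs_imag !ger0_norm ?(ltW w0)//.
  apply: ler_pM => //; rewrite ?(ltW w0)// lerDr mulr_ge0 ?mulr_ge0 ?ltW//.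
have off (s : R) : `|s| = 1 ->
    cabs (s * (2 * mu P * alphan P n * X - w * alphan P n))%:C%C <=
    (2 * mu P * X + w) * growth P n.
  move=> s1; rewrite cabs_real normrM s1 mul1r (le_trans (ler_normB _ _))//.
  rewrite mulrAC !normrM (gtr0_norm mu0) (gtr0_norm w0) (gtr0_norm X0).
  rewrite (ger0_norm (ler0n R 2)).
  rewrite -mulrDl ler_wpM2l// addr_ge0 ?mulr_ge0 ?ltW//.
rewrite /Wn mxE; apply: entry; rewrite -wE b1 b2 XE.
case: ifP => _; case: ifP => _.
- by apply: diag; rewrite ?sqrtr_ge0 ?sqrt_le_growth.
- apply: le_trans (off (-1) _); rewrite ?normrN1// le_eqVlt; apply/orP; left; apply/eqP.
  by congr cabs; rewrite !rmorphM rmorphB !rmorphM rmorphN1; ring.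
- apply: le_trans (off 1 _); rewrite ?normr1// le_eqVlt; apply/orP; left; apply/eqP.
  by congr cabs; rewrite mul1r rmorphB !rmorphM; ring.
- by apply: diag; rewrite ?sqrtr_ge0 ?sqrt_le_growth.
Qed.

End Multipliers.

(** * Linearity of the volume and interface terms *)

Section ProblemForms.
Context {R : realType} (P : setting R).
Hypothesis hP : standing P.

Lemma surf_lipschitz : exists k, forall x y, `|surf P x - surf P y| <= k * `|x - y|.
Proof.
have [k [_ kP]] := surf_lip hP; exists (k + 1) => x y.
by apply: (kP (k + 1) _ (x, y)); [rewrite ltrDl|split].
Qed.

Lemma surf_continuous : continuous (surf P).
Proof. by have [k] := surf_lipschitz; exact: lipschitz_continuous_fun. Qed.

Let M : R := `|height1 P| + `|height2 P| + `|delta2 P|.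

Let bounded_between (x : R) :
  height2 P - delta2 P <= x <= height1 P -> `|x| <= M.
Proof.
have [_ d2] := delta_gt0 hP; have a1 := ler_norm (height1 P).
have a2 := ler_norm (- height2 P); rewrite normrN in a2.
have [b1 b2] := (normr_ge0 (height1 P), normr_ge0 (height2 P)).
have b3 := ler_norm (delta2 P).
by move=> /andP[x1 x2]; rewrite /M ler_norml; apply/andP; split; lra.
Qed.

Let surf_bounded x : `|surf P x| <= M.
Proof.
have /andP[s1 s2] := surf_between hP x; have [_ d2] := delta_gt0 hP.
by apply: bounded_between; apply/andP; split; lra.
Qed.

Lemma tame_plus : tame_profiles (surf P) (cst (height1 P)).
Proof.
split; [exact: surf_continuous|exact: cst_continuous|exists M => x].
split=> //; apply: bounded_between; have [_ d2] := delta_gt0 hP.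
by have := height_lt hP => h; rewrite /cst; apply/andP; split; lra.
Qed.

Lemma tame_minus : tame_profiles (cst (height2 P)) (surf P).
Proof.
split; [exact: cst_continuous|exact: surf_continuous|exists M => x].
split=> //; apply: bounded_between; have [_ d2] := delta_gt0 hP.
by have := height_lt hP => h; rewrite /cst; apply/andP; split; lra.
Qed.

Lemma tame_layer : tame_profiles (cst (height2 P - delta2 P)) (cst (height2 P)).
Proof.
split; [exact: cst_continuous|exact: cst_continuous|exists M => x].
have [_ d2] := delta_gt0 hP; have := height_lt hP => h.
by split; apply: bounded_between; rewrite /cst; apply/andP; split; lra.
Qed.

Lemma H1minus_lin (c : R[i]) (u w : vsob R) :
  H1minus P u -> H1minus P w -> H1minus P (c *: u + w).
Proof. by move=> hu hw i; exact: (H1qp_lin c tame_minus (hu i) (hw i)). Qed.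

Lemma H1layer_lin (c : R[i]) (u w : vsob R) :
  H1layer P u -> H1layer P w -> H1layer P (c *: u + w).
Proof. by move=> hu hw i; exact: (H1qp_lin c tame_layer (hu i) (hw i)). Qed.

Lemma HH_lin (c : R[i]) (U V : hsob R) :
  HH P U -> HH P V -> HH P (c *: U + V).
Proof.
move=> [p u] [q w]; split; last exact: (H1minus_lin c u w).
exact: (H1qp_lin c tame_plus p q).
Qed.

Lemma vfn_lin (c : R[i]) (u w : vsob R) i x :
  fn ((c *: u + w) i) x = c * fn (u i) x + fn (w i) x.
Proof. by []. Qed.

Lemma vpd_lin (c : R[i]) (u w : vsob R) i j x :
  pd ((c *: u + w) i) j x = c * pd (u i) j x + pd (w i) j x.
Proof. by []. Qed.

Lemma vbot_lin (c : R[i]) (u w : vsob R) i x :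
  bot ((c *: u + w) i) x = c * bot (u i) x + bot (w i) x.
Proof. by []. Qed.

Lemma vtop_lin (c : R[i]) (u w : vsob R) i x :
  top ((c *: u + w) i) x = c * top (u i) x + top (w i) x.
Proof. by []. Qed.

Lemma H1qp_L2 a b v : H1qp P a b v ->
  [/\ L2 (leb2 R) (strip P a b) (fn v),
      forall i, L2 (leb2 R) (strip P a b) (pd v i),
      L2 (leb1 R) (period P) (bot v) & L2 (leb1 R) (period P) (top v)].
Proof. by move=> [Lv dv [Lb _] [Lt _] _]; split => // i; case: (dv i). Qed.

Lemma acoustic_form_linl (c : R[i]) p q phi :
  H1plus P p -> H1plus P q -> H1plus P phi ->
  acoustic_form P (c *: p + q) phi =
  c * acoustic_form P p phi + acoustic_form P q phi.
Proof.
move=> /H1qp_L2[p0 p1 _ _] /H1qp_L2[q0 q1 _ _] /H1qp_L2[f0 f1 _ _].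
have mD := strip_measurable P tame_plus.
have it (r : sob R) : L2 (leb2 R) (Oplus P) (fn r) ->
    (forall i, L2 (leb2 R) (Oplus P) (pd r i)) ->
    cintegrable (leb2 R) (Oplus P) (fun x =>
      \sum_(i < 2) pd r i x * (pd phi i x)^*%C -
      (kappa P ^+ 2)%:C%C * fn r x * (fn phi x)^*%C).
  move=> r0 r1; apply: cintegrableB => //.
    by apply: cintegrable_sum => // i; exact: L2MJ.
  by apply: L2MJ => //; exact: L2Z.
rewrite /acoustic_form -cint_lin; [|exact: mD|exact: it|exact: it].
apply: eq_cint => x _; rewrite !big_ord_recl !big_ord0 !pd_lin !fn_lin; ring.
Qed.

Lemma elastic_form_linl (c : R[i]) u w psi :
  H1minus P u -> H1minus P w -> H1minus P psi ->
  elastic_form P (c *: u + w) psi =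
  c * elastic_form P u psi + elastic_form P w psi.
Proof.
move=> hu hw hpsi; have mD := strip_measurable P tame_minus.
have it (r : vsob R) : H1minus P r -> cintegrable (leb2 R) (Ominus P) (fun x =>
    Elm P r psi x - (omega P ^+ 2 * rho P)%:C%C *
      \sum_(i < 2) fn (r i) x * (fn (psi i) x)^*%C).
  move=> hr.
  have L2pd (v : vsob R) i j : H1minus P v -> L2 (leb2 R) (Ominus P) (pd (v i) j).
    by move=> /(_ i) /H1qp_L2[].
  have L2fn (v : vsob R) i : H1minus P v -> L2 (leb2 R) (Ominus P) (fn (v i)).
    by move=> /(_ i) /H1qp_L2[].
  have L2div (v : vsob R) : H1minus P v -> L2 (leb2 R) (Ominus P) (div2 v).
    by move=> hv; apply: L2_sum => // i; exact: L2pd.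
  apply: cintegrableB => //; first apply: cintegrableD => //.
  - by apply: L2MJ => //; [apply: L2Z => //; exact: L2div|exact: L2div].
  - apply: cintegrableZ => //; apply: cintegrable_sum => // i.
    apply: cintegrable_sum => // j.
    by apply: L2MJ => //; apply: L2D => //; exact: L2pd.
  - apply: cintegrableZ => //; apply: cintegrable_sum => // i.
    by apply: L2MJ => //; exact: L2fn.
rewrite /elastic_form -cint_lin; [|exact: mD|exact: it|exact: it].
apply: eq_cint => x _; rewrite /Elm /div2 !big_ord_recl !big_ord0 !vpd_lin !vfn_lin.
ring.
Qed.

Lemma arc_ge1 x : 1 <= Defs.arc P x.
Proof. by rewrite -[X in X <= _]sqrtr1 ler_wsqrtr// lerDl sqr_ge0. Qed.

Let derivative_bound : exists B, 0 <= B /\ forall x, `|derive1 (surf P) x| <= B.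
Proof.
have [k lk] := surf_lipschitz; exists (Num.max k `|point : R|); split.
  by rewrite le_max normr_ge0 orbT.
exact: derive1_lipschitz_le.
Qed.

Let derivative_measurable :
  measurable_fun setT (derive1 (surf P) : measurableTypeR R -> R).
Proof. by have [k lk] := surf_lipschitz; exact: derive1_lipschitz_measurable lk. Qed.

Lemma arc_measurable : measurable_fun setT (Defs.arc P : measurableTypeR R -> R).
Proof.
(* The arc length density is a modulus, so no square root needs measuring. *)
rewrite (_ : Defs.arc P = fun x => cabs (1 +i* derive1 (surf P) x)%C).
  by apply: cmeas_cabs; split => //=; exact: measurable_cst.
by apply/funext => x; rewrite /Defs.arc /cabs /= expr1n.
Qed.

Lemma arc_cmeas :
  cmeas (period P : set (measurableTypeR R)) (fun x => (Defs.arc P x)%:C%C).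
Proof. by apply: cmeas_real; exact: measurable_funTS arc_measurable. Qed.

Lemma arc_bounded : exists B, forall x, cabs (Defs.arc P x)%:C%C <= B.
Proof.
have [B [B0 dB]] := derivative_bound; exists (Num.sqrt (1 + B ^+ 2)) => x.
rewrite cabs_real ger0_norm ?sqrtr_ge0// ler_wsqrtr// lerD2l.
by rewrite -[leLHS]real_normK ?num_real// ler_pXn2r ?nnegrE.
Qed.

Lemma normal_cmeas i :
  cmeas (period P : set (measurableTypeR R)) (fun x => (normal P i x)%:C%C).
Proof.
apply: cmeas_real; apply: measurable_funTS.
rewrite (_ : normal P i = fun x => (if i == ord0 then - derive1 (surf P) x else 1) *
    (Defs.arc P x) `^ (-1)).
  apply: measurable_funM;
    last exact: (measurableT_comp (@measurable_powR R (-1)) arc_measurable).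
  case: (i == ord0); last exact: measurable_cst.
  exact: measurable_funN.
by apply/funext => x; rewrite /normal powR_inv1// (le_trans ler01)// arc_ge1.
Qed.

Lemma normal_bounded i : exists B, forall x, cabs (normal P i x)%:C%C <= B.
Proof.
have [B [B0 dB]] := derivative_bound; exists (B + 1) => x.
rewrite cabs_real /normal normf_div.
have a1 := arc_ge1 x; rewrite [X in _ / X]gtr0_norm ?(lt_le_trans ltr01 a1)//.
rewrite ler_pdivrMr ?(lt_le_trans ltr01 a1)// (le_trans (_ : _ <= B + 1))//.
  case: ifP => _; first by rewrite normrN (le_trans (dB x))// lerDl.
  by rewrite normr1 lerDr.
by rewrite ler_peMr// addr_ge0.
Qed.

Lemma L2_normal (f : 'I_2 -> R -> R[i]) :
  (forall i, L2 (leb1 R) (period P) (f i)) ->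
  L2 (leb1 R) (period P) (fun x => \sum_(i < 2) (normal P i x)%:C%C * f i x).
Proof.
move=> Lf; have mp := period_measurable P; apply: L2_sum => // i.
have [B nB] := normal_bounded i.
exact: (L2_bounded mp (normal_cmeas i) (fun x _ => nB x) (Lf i)).
Qed.

Lemma int_Gamma_lin (c : R[i]) (f g h : R -> R[i]) :
  L2 (leb1 R) (period P) f -> L2 (leb1 R) (period P) g ->
  L2 (leb1 R) (period P) h ->
  int_Gamma P (fun x => (c * f x + g x) * h x) =
  c * int_Gamma P (fun x => f x * h x) + int_Gamma P (fun x => g x * h x).
Proof.
move=> Lf Lg Lh; have mp := period_measurable P; have [B aB] := arc_bounded.
have it k : L2 (leb1 R) (period P) k ->
    cintegrable (leb1 R) (period P) (fun x => k x * h x * (Defs.arc P x)%:C%C).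
  move=> Lk.
  rewrite (_ : (fun x => _) = fun x => ((Defs.arc P x)%:C%C * k x) * h x).
    apply: L2M => //.
    exact: (L2_bounded mp arc_cmeas (fun x _ => aB x) Lk).
  by apply/funext => x; ring.
rewrite /int_Gamma -cint_lin; [|exact: mp|exact: it|exact: it].
by apply: eq_cint => x _; ring.
Qed.

(** The volume and interface terms do not involve the boundary operators, which
  therefore enter only through their own linearity. *)
Lemma Agen_linl Tp Tm (c : R[i]) (U W V : hsob R) :
  HH P U -> HH P W -> HH P V ->
  Tp (c *: U + W).1 V.1 = c * Tp U.1 V.1 + Tp W.1 V.1 ->
  Tm (c *: U + W).2 V.2 = c * Tm U.2 V.2 + Tm W.2 V.2 ->
  Agen P Tp Tm (c *: U + W) V = c * Agen P Tp Tm U V + Agen P Tp Tm W V.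
Proof.
move=> [hp hu] [hq hw] [hphi hpsi] eTp eTm; rewrite /Agen eTp eTm.
have -> : (c *: U + W).1 = c *: U.1 + W.1 by [].
have -> : (c *: U + W).2 = c *: U.2 + W.2 by [].
rewrite acoustic_form_linl// elastic_form_linl//.
have mp := period_measurable P.
have [_ _ Lbp _] := H1qp_L2 hp; have [_ _ Lbq _] := H1qp_L2 hq.
have [_ _ Lbphi _] := H1qp_L2 hphi.
have L2top (v : vsob R) i : H1minus P v -> L2 (leb1 R) (period P) (top (v i)).
  by move=> /(_ i) /H1qp_L2[].
rewrite [X in _ + X + _ - _ - _ = _](_ : _ =
    c * int_Gamma P (fun x => bot U.1 x *
      \sum_(i < 2) (normal P i x)%:C%C * (top (V.2 i) x)^*%C) +
    int_Gamma P (fun x => bot W.1 x *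
      \sum_(i < 2) (normal P i x)%:C%C * (top (V.2 i) x)^*%C)); last first.
  rewrite -int_Gamma_lin//.
  apply: (L2_normal (f := fun i x => (top (V.2 i) x)^*%C)) => i.
  by apply: L2J => //; exact: L2top.
have Lrho (v : vsob R) : H1minus P v -> L2 (leb1 R) (period P) (fun x =>
    (rhof P * omega P ^+ 2)%:C%C * \sum_(i < 2) top (v i) x * (normal P i x)%:C%C).
  move=> hv; apply: L2Z => //.
  under [X in L2 _ _ X]funext do under eq_bigr do rewrite mulrC.
  by apply: L2_normal => i; exact: L2top.
rewrite [X in _ + X - _ - _ = _](_ : _ =
    c * int_Gamma P (fun x => (rhof P * omega P ^+ 2)%:C%C *
      (\sum_(i < 2) top (U.2 i) x * (normal P i x)%:C%C) * (bot V.1 x)^*%C) +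
    int_Gamma P (fun x => (rhof P * omega P ^+ 2)%:C%C *
      (\sum_(i < 2) top (W.2 i) x * (normal P i x)%:C%C) * (bot V.1 x)^*%C)); last first.
  rewrite -int_Gamma_lin//; [|exact: Lrho|exact: Lrho|exact: L2J].
  congr int_Gamma; apply/funext => x.
  by rewrite !big_ord_recl !big_ord0 !vtop_lin; ring.
ring.
Qed.

End ProblemForms.

(** * The layer problem and the boundary operators *)

Lemma ae_impl2 d (T : measurableType d) (R : realType)
  (mu : {measure set T -> \bar R}) (A B C : T -> Prop) :
  (forall x, A x -> B x -> C x) ->
  {ae mu, forall x, A x} -> {ae mu, forall x, B x} -> {ae mu, forall x, C x}.
Proof. by move=> ABC; apply: filterS2. Qed.

Lemma ae_forall d (T : measurableType d) (R : realType)
  (mu : {measure set T -> \bar R}) (I : finType) (A : I -> T -> Prop) :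
  (forall i, {ae mu, forall x, A i x}) -> {ae mu, forall x, forall i, A i x}.
Proof. exact: filter_forall. Qed.

Section LayerProblem.
Context {R : realType} (P : setting R).
Hypothesis hP : standing P.
Implicit Types u v w psi Psi : vsob R.

Let mD : measurable (Olayer P : set (measurableTypeR R * measurableTypeR R)).
Proof. exact: strip_measurable (tame_layer hP). Qed.

Lemma layer_L2 w : H1layer P w ->
  (forall i j, L2 (leb2 R) (Olayer P) (pd (w i) j)) /\
  (forall i, L2 (leb2 R) (Olayer P) (fn (w i))).
Proof.
by move=> hw; split=> [i j|i]; have /H1qp_L2[? ? _ _] := hw i.
Qed.

Let spml_layer_cmeas : cmeas (Olayer P : set (measurableTypeR R * measurableTypeR R))
  (fun x => spml P x.2).
Proof.
have [m1 m2] := spml_cmeas P.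
by split; apply: measurable_funTS; [exact: (measurableT_comp m1 measurable_snd)
  |exact: (measurableT_comp m2 measurable_snd)].
Qed.

Let spml_inv_layer_cmeas : cmeas (Olayer P : set (measurableTypeR R * measurableTypeR R))
  (fun x => (spml P x.2)^-1).
Proof.
have [m1 m2] := spml_inv_cmeas hP.
by split; apply: measurable_funTS; [exact: (measurableT_comp m1 measurable_snd)
  |exact: (measurableT_comp m2 measurable_snd)].
Qed.

Lemma L2_spml f : L2 (leb2 R) (Olayer P) f ->
  L2 (leb2 R) (Olayer P) (fun x => spml P x.2 * f x).
Proof.
apply: (L2_bounded mD spml_layer_cmeas (M := 1 + cabs (sigma1 P) + cabs (sigma2 P))).
move=> x [_]; rewrite /cst => /andP[x1 x2]; apply: spml_bounded => //.
have [d1 _] := delta_gt0 hP; have := height_lt hP => h.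
by apply/andP; split; lra.
Qed.

Lemma L2_stretch j f : L2 (leb2 R) (Olayer P) f ->
  L2 (leb2 R) (Olayer P) (fun x => stretch P x j (f x)).
Proof.
move=> Lf; rewrite /stretch; case: (j == ord0) => //.
under [X in L2 _ _ X]funext do rewrite mulrC.
by apply: (L2_bounded mD spml_inv_layer_cmeas _ Lf) => x _; exact: cabs_spml_inv.
Qed.

Lemma stretch_lin (c a b : R[i]) x j :
  stretch P x j (c * a + b) = c * stretch P x j a + stretch P x j b.
Proof. by rewrite /stretch; case: ifP => // _; rewrite mulrDl mulrA. Qed.

Lemma stretch0 x j : stretch P x j 0 = 0.
Proof. by rewrite /stretch; case: ifP => // _; rewrite mul0r. Qed.

Lemma stress_hat_lin (c : R[i]) v w i j x :
  stress_hat P (c *: v + w) i j x = c * stress_hat P v i j x + stress_hat P w i j x.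
Proof.
rewrite /stress_hat; case: (i == j);
  rewrite ?big_ord_recl ?big_ord0 !vpd_lin !stretch_lin; ring.
Qed.

Lemma L2_stress w i j : H1layer P w -> L2 (leb2 R) (Olayer P) (stress_hat P w i j).
Proof.
move=> /layer_L2[Lpd _]; apply: L2D => //.
  case: (i == j); last exact: L2_0.
  by apply: L2Z => //; apply: L2_sum => // k; exact: L2_stretch.
by apply: L2Z => //; apply: L2D => //; exact: L2_stretch.
Qed.

Definition layer_integrand w Psi x : R[i] := spml P x.2 *
    (\sum_(i < 2) \sum_(j < 2)
       stress_hat P w i j x * stretch P x j (pd (Psi i) j x)^*%C -
     (omega P ^+ 2 * rho P)%:C%C *
       \sum_(i < 2) fn (w i) x * (fn (Psi i) x)^*%C).

Lemma layer_integrable w Psi : H1layer P w -> H1layer P Psi ->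
  cintegrable (leb2 R) (Olayer P) (layer_integrand w Psi).
Proof.
move=> hw hPsi; have [_ Lw] := layer_L2 hw; have [Lp Lf] := layer_L2 hPsi.
rewrite (_ : layer_integrand w Psi = fun x =>
    \sum_(i < 2) \sum_(j < 2) (spml P x.2 * stress_hat P w i j x) *
       stretch P x j (pd (Psi i) j x)^*%C -
    (omega P ^+ 2 * rho P)%:C%C *
      \sum_(i < 2) (spml P x.2 * fn (w i) x) * (fn (Psi i) x)^*%C).
  apply: cintegrableB => //.
    apply: cintegrable_sum => // i; apply: cintegrable_sum => // j.
    apply: L2M => //; first by apply: L2_spml; exact: L2_stress.
    by apply: L2_stretch; exact: L2J.
  apply: cintegrableZ => //; apply: cintegrable_sum => // i.
  by apply: L2MJ => //; exact: L2_spml.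
by apply/funext => x; rewrite /layer_integrand !big_ord_recl !big_ord0; ring.
Qed.

Lemma layer_form_linl (c : R[i]) v w Psi :
  H1layer P v -> H1layer P w -> H1layer P Psi ->
  layer_form P (c *: v + w) Psi = c * layer_form P v Psi + layer_form P w Psi.
Proof.
move=> hv hw hPsi; rewrite /layer_form -cint_lin;
  [|exact: mD|exact: layer_integrable|exact: layer_integrable].
apply: eq_cint => x _.
rewrite !big_ord_recl !big_ord0 !(stress_hat_lin c v w) !(vfn_lin c v w); ring.
Qed.

Lemma layer_form_linr (c : R[i]) w Phi Psi :
  H1layer P w -> H1layer P Phi -> H1layer P Psi ->
  layer_form P w (c *: Phi + Psi) =
  c^*%C * layer_form P w Phi + layer_form P w Psi.
Proof.
move=> hw hPhi hPsi; rewrite /layer_form -cint_lin;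
  [|exact: mD|exact: layer_integrable|exact: layer_integrable].
apply: eq_cint => x _.
have pdE i j : stretch P x j (pd ((c *: Phi + Psi) i) j x)^*%C =
    c^*%C * stretch P x j (pd (Phi i) j x)^*%C + stretch P x j (pd (Psi i) j x)^*%C.
  by rewrite vpd_lin rmorphD rmorphM stretch_lin.
have fnE i : (fn ((c *: Phi + Psi) i) x)^*%C =
    c^*%C * (fn (Phi i) x)^*%C + (fn (Psi i) x)^*%C.
  by rewrite vfn_lin rmorphD rmorphM.
under eq_bigr => i _ do under eq_bigr => j _ do rewrite pdE.
under [X in _ * (_ - _ * X) = _]eq_bigr => i _ do rewrite fnE.
rewrite !big_ord_recl !big_ord0; ring.
Qed.

Lemma layer_lift_lin (c : R[i]) (g h : 'I_2 -> R -> R[i]) v w :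
  layer_lift P g v -> layer_lift P h w ->
  layer_lift P (fun i x => c * g i x + h i x) (c *: v + w).
Proof.
move=> [hv tv] [hw tw]; split; first exact: H1layer_lin.
move=> i; have [[tv1 tv2] [tw1 tw2]] := (tv i, tw i); split.
- by apply: ae_impl2 tv1 tw1 => x e1 e2 px; rewrite vtop_lin e1 ?e2.
- by apply: ae_impl2 tv2 tw2 => x e1 e2 px; rewrite vbot_lin e1 ?e2 ?mulr0 ?addr0.
Qed.

Lemma layer_sol_lin (c : R[i]) u v w w' : layer_sol P u w -> layer_sol P v w' ->
  layer_sol P (c *: u + v) (c *: w + w').
Proof.
move=> [lw sw] [lw' sw']; split.
  have := layer_lift_lin c lw lw'. exact.
move=> Psi lPsi; rewrite layer_form_linl ?sw ?sw' ?mulr0 ?addr0//.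
- exact: lw.1.
- exact: lw'.1.
- exact: lPsi.1.
Qed.

(** The norm controls the mean square of every component of [d], so each of them
  vanishes almost everywhere. *)
Lemma layer_form_null d Psi : H1layer P d -> H1layer P Psi ->
  normlayer P d = 0 -> layer_form P d Psi = 0.
Proof.
move=> hd hPsi; have [Lp Lf] := layer_L2 hd.
rewrite /normlayer; set I := Rintegral _ _ _ => sI0.
pose e x : R := \sum_(i < 2)
  (\sum_(j < 2) cabs (pd (d i) j x) ^+ 2 + cabs (fn (d i) x) ^+ 2).
have isq f : L2 (leb2 R) (Olayer P) f ->
    (leb2 R).-integrable (Olayer P) (EFin \o (fun x => cabs (f x) ^+ 2)).
  by move=> /L2P[].
have ie : (leb2 R).-integrable (Olayer P) (EFin \o e).
  rewrite (_ : e = fun x => ((cabs (pd (d ord0) ord0 x) ^+ 2 +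
      cabs (pd (d ord0) (lift ord0 ord0) x) ^+ 2) + cabs (fn (d ord0) x) ^+ 2) +
      ((cabs (pd (d (lift ord0 ord0)) ord0 x) ^+ 2 +
      cabs (pd (d (lift ord0 ord0)) (lift ord0 ord0) x) ^+ 2) +
      cabs (fn (d (lift ord0 ord0)) x) ^+ 2)).
    by do ! (apply: integrable_realD => //); exact: isq.
  by apply/funext => x; rewrite /e !big_ord_recl !big_ord0 !addr0.
have I0 : I = 0.
  apply/eqP; rewrite eq_le -sqrtr_eq0 sI0 eqxx /=.
  apply: Rintegral_ge0 => x _; apply: sumr_ge0 => i _.
  by rewrite addr_ge0 ?sqr_ge0// sumr_ge0// => j _; exact: sqr_ge0.
have null f : L2 (leb2 R) (Olayer P) f -> (forall x, cabs (f x) ^+ 2 <= e x) ->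
    {ae leb2 R, forall x, Olayer P x -> f x = 0}.
  move=> L fe; apply: L2_null => //; apply/eqP; rewrite eq_le; apply/andP; split.
    rewrite -I0; apply: le_Rintegral => //; exact: isq.
  by apply: Rintegral_ge0 => x _; exact: sqr_ge0.
have p0 : {ae leb2 R, forall x, forall ij : 'I_2 * 'I_2,
    Olayer P x -> pd (d ij.1) ij.2 x = 0}.
  apply: ae_forall => -[i j]; apply: null => // x /=.
  rewrite /e (bigD1 i)//= (bigD1 j)//= -!addrA lerDl !addr_ge0 ?sqr_ge0 ?sumr_ge0//.
    by move=> k _; exact: sqr_ge0.
  by move=> k _; rewrite addr_ge0 ?sqr_ge0// sumr_ge0// => l _; exact: sqr_ge0.
have f0 : {ae leb2 R, forall x, forall i : 'I_2, Olayer P x -> fn (d i) x = 0}.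
  apply: ae_forall => i; apply: null => // x.
  rewrite /e (bigD1 i)//= -addrA addrCA lerDl !addr_ge0 ?sumr_ge0//.
    by move=> k _; exact: sqr_ge0.
  by move=> k _; rewrite addr_ge0 ?sqr_ge0// sumr_ge0// => l _; exact: sqr_ge0.
have [i1 i2] := layer_integrable hd hPsi.
apply: cint_ae0 => //.
  by split; apply/measurable_EFinP; [exact: measurable_int i1|exact: measurable_int i2].
apply: ae_impl2 p0 f0 => x px fx Dx.
rewrite (_ : \sum_(i < 2) \sum_(j < 2) _ = 0); last first.
  rewrite big1// => i _; rewrite big1// => j _.
  rewrite (_ : stress_hat P d i j x = 0) ?mul0r// /stress_hat big1 => [|k _].
    by rewrite (px (i, j))// (px (j, i))// !stretch0 !addr0 !mulr0 if_same addr0.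
  by rewrite (px (k, k))// stretch0.
by rewrite big1 ?mulr0 ?subrr ?mulr0// => i _; rewrite fx// mul0r.
Qed.

Hypothesis hlayer : layer_uniquely_solvable P.

(** Two lifts [Psi] differ by a test field of the layer problem, and two solutions
  [w] by a field of vanishing norm, so the pairing does not depend on the choice
  made in its definition. Linearity in both arguments rests on this. *)
Lemma TminusPML_pairE u psi w Psi :
  H1minus P u -> H1minus P psi -> layer_sol P u w ->
  layer_lift P (fun i => bot (psi i)) Psi ->
  TminusPML_pair P u psi = - layer_form P w Psi.
Proof.
move=> hu hpsi sw lPsi; rewrite /TminusPML_pair.
apply: xget_unique; first by exists w, Psi.
move=> _ [w' [Psi' [sw' lPsi' ->]]].
have [w0 [sw0 uniq]] := hlayer hu.
have H1l g v : layer_lift P g v -> H1layer P v by case.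
have same v : layer_sol P u v -> layer_form P v Psi = layer_form P w0 Psi.
  move=> sv; have n0 := uniq _ sv.
  have e : v - w0 = (-1) *: w0 + v by rewrite scaleN1r addrC.
  have h0 : H1layer P w0 := H1l _ _ sw0.1.
  have hv : H1layer P v := H1l _ _ sv.1.
  have hd : H1layer P (v - w0) by rewrite e; exact: H1layer_lin.
  have := layer_form_null hd (H1l _ _ lPsi) n0.
  rewrite e layer_form_linl//; last exact: H1l lPsi.
  by rewrite mulN1r addrC => /eqP; rewrite subr_eq0 => /eqP.
have lift : layer_form P w' Psi' = layer_form P w' Psi.
  have l0 : layer_lift P (fun _ _ => 0) ((-1) *: Psi + Psi').
    have := layer_lift_lin (-1) lPsi lPsi'; congr layer_lift.
    by apply/funext => i; apply/funext => x; rewrite mulN1r addNr.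
  have := sw'.2 _ l0.
  rewrite layer_form_linr; [|exact: H1l sw'.1|exact: H1l lPsi|exact: H1l lPsi'].
  rewrite rmorphN1 mulN1r addrC => /eqP; by rewrite subr_eq0 => /eqP.
by rewrite lift (same _ sw') (same _ sw).
Qed.

Lemma TminusPML_linl (c : R[i]) u v psi :
  H1minus P u -> H1minus P v -> H1minus P psi ->
  TminusPML_pair P (c *: u + v) psi =
  c * TminusPML_pair P u psi + TminusPML_pair P v psi.
Proof.
move=> hu hv hpsi; have [w [sw _]] := hlayer hu; have [w' [sw' _]] := hlayer hv.
have [Psi [[lPsi _] _]] := hlayer hpsi.
rewrite (TminusPML_pairE _ hpsi (layer_sol_lin c sw sw') lPsi); last exact: H1minus_lin.
rewrite (TminusPML_pairE hu hpsi sw lPsi) (TminusPML_pairE hv hpsi sw' lPsi).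
rewrite layer_form_linl; [ring|exact: sw.1.1|exact: sw'.1.1|exact: lPsi.1].
Qed.

Lemma TminusPML_linr (c : R[i]) u phi psi :
  H1minus P u -> H1minus P phi -> H1minus P psi ->
  TminusPML_pair P u (c *: phi + psi) =
  c^*%C * TminusPML_pair P u phi + TminusPML_pair P u psi.
Proof.
move=> hu hphi hpsi; have [w [sw _]] := hlayer hu.
have [Phi [[lPhi _] _]] := hlayer hphi; have [Psi [[lPsi _] _]] := hlayer hpsi.
have lift : layer_lift P (fun i => bot ((c *: phi + psi) i)) (c *: Phi + Psi).
  exact: (layer_lift_lin c lPhi lPsi).
rewrite (TminusPML_pairE hu _ sw lift); last exact: H1minus_lin.
rewrite (TminusPML_pairE hu hphi sw lPhi) (TminusPML_pairE hu hpsi sw lPsi).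
rewrite layer_form_linr; [ring|exact: sw.1.1|exact: lPhi.1|exact: lPsi.1].
Qed.

End LayerProblem.

Lemma sum_I2 (V : nmodType) (F : 'I_2 -> V) :
  \sum_(i < 2) F i = F ord0 + F (lift ord0 ord0).
Proof. by rewrite !big_ord_recl big_ord0 addr0. Qed.

Section BoundaryForms.
Context {R : realType} (P : setting R).
Hypothesis hP : standing P.
Hypothesis htrace : trace_inequalities P.

Lemma half_trace_top V : HH P V -> half_trace P (top V.1).
Proof.
move=> hV; have [_ b _ _] := htrace hV; split; last exact: le_lt_trans b (ltry _).
by have [h _] := hV; have [_ _ _] := H1qp_L2 h.
Qed.

Lemma half_trace_bot V i : HH P V -> half_trace P (bot (V.2 i)).
Proof.
move=> hV; have [_ _ _ b] := htrace hV; split.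
  by have [_ h] := hV; have [_ _ ] := H1qp_L2 (h i).
have nn j : (0 <= hhalf2 P (bot (V.2 j)))%E.
  rewrite mule_ge0 ?lee_fin ?(ltW (Lam_gt0 hP))// esum_ge0// => n _.
  by rewrite lee_fin mulr_ge0 ?sqrtr_ge0 ?sqr_ge0.
apply: le_lt_trans (le_lt_trans b (ltry _)).
rewrite /hhalf /vhhalf lee_sqrt; last by apply: sume_ge0 => j _.
rewrite (bigD1 i)//= leeDl// sume_ge0// => j _; exact: nn.
Qed.

Lemma Tplus_pairE p phi : Tplus_pair P p phi =
  pairing P (fun n => iC R * betan P (kappa P) n) (top p) (top phi).
Proof. by []. Qed.

Lemma TplusPML_pairE p phi : TplusPML_pair P p phi =
  pairing P (fun n => iC R * betan P (kappa P) n *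
    ccoth (- (iC R * betan P (kappa P) n * eta1 P))) (top p) (top phi).
Proof. by []. Qed.

Lemma Tminus_pairE U V : HH P U -> HH P V -> Tminus_pair P U.2 V.2 =
  \sum_(i < 2) \sum_(j < 2) pairing P (fun n => Wn P n i j) (bot (U.2 j)) (bot (V.2 i)).
Proof.
move=> hU hV; apply: eq_bigr => i _.
have s j := order_one_summable (Lam_gt0 hP) (Wn_order_one hP i j)
  (half_trace_bot j hU) (half_trace_bot i hV).
rewrite sum_I2 /pairing /dual -mulrDr; congr (_ * _).
rewrite -[X in X + _]mul1r -csumZ_lin; [|exact: s|exact: s].
congr csumZ; apply/funext => n.
by rewrite /Tminus sum_I2; ring.
Qed.

Lemma Tminus_linl (c : R[i]) U W V : HH P U -> HH P W -> HH P V ->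
  Tminus_pair P (c *: U + W).2 V.2 =
  c * Tminus_pair P U.2 V.2 + Tminus_pair P W.2 V.2.
Proof.
move=> hU hW hV; have hS := HH_lin hP c hU hW.
rewrite (Tminus_pairE hS hV) (Tminus_pairE hU hV) (Tminus_pairE hW hV).
rewrite mulr_sumr -big_split; apply: eq_bigr => i _ /=.
rewrite mulr_sumr -big_split; apply: eq_bigr => j _ /=.
exact: (pairing_linl (Lam_gt0 hP) c (Wn_order_one hP i j) (half_trace_bot j hU)
  (half_trace_bot j hW) (half_trace_bot i hV)).
Qed.

Lemma Tminus_linr (c : R[i]) U V W : HH P U -> HH P V -> HH P W ->
  Tminus_pair P U.2 (c *: V + W).2 =
  c^*%C * Tminus_pair P U.2 V.2 + Tminus_pair P U.2 W.2.
Proof.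
move=> hU hV hW; have hS := HH_lin hP c hV hW.
rewrite (Tminus_pairE hU hS) (Tminus_pairE hU hV) (Tminus_pairE hU hW).
rewrite mulr_sumr -big_split; apply: eq_bigr => i _ /=.
rewrite mulr_sumr -big_split; apply: eq_bigr => j _ /=.
exact: (pairing_linr (Lam_gt0 hP) c (Wn_order_one hP i j) (half_trace_bot j hU)
  (half_trace_bot i hV) (half_trace_bot i hW)).
Qed.

Lemma A_linl (c : R[i]) U W V : HH P U -> HH P W -> HH P V ->
  A P (c *: U + W) V = c * A P U V + A P W V.
Proof.
move=> hU hW hV; apply: Agen_linl => //; last exact: Tminus_linl.
exact: (pairing_linl (Lam_gt0 hP) c (Tplus_order_one hP) (half_trace_top hU)
  (half_trace_top hW) (half_trace_top hV)).
Qed.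

(** This is [A - A^PML], as only the boundary operators differ. *)
Definition boundary_defect (U V : hsob R) : R[i] :=
  (TplusPML_pair P U.1 V.1 - Tplus_pair P U.1 V.1) +
  (TminusPML_pair P U.2 V.2 - Tminus_pair P U.2 V.2).

Lemma APML_defect U V : APML P U V = A P U V - boundary_defect U V.
Proof. by rewrite /APML /A /Agen /boundary_defect; ring. Qed.

Hypothesis hlayer : layer_uniquely_solvable P.

Let regroup (c a a' b b' p p' q q' : R[i]) :
  (c * a + a' - (c * b + b')) + (c * p + p' - (c * q + q')) =
  c * ((a - b) + (p - q)) + ((a' - b') + (p' - q')).
Proof. by ring. Qed.

Lemma boundary_defect_linl (c : R[i]) U W V : HH P U -> HH P W -> HH P V ->
  boundary_defect (c *: U + W) V = c * boundary_defect U V + boundary_defect W V.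
Proof.
move=> hU hW hV; rewrite /boundary_defect Tminus_linl//.
rewrite (TminusPML_linl hP hlayer c hU.2 hW.2 hV.2) !TplusPML_pairE !Tplus_pairE.
rewrite (pairing_linl (Lam_gt0 hP) c (Tplus_order_one hP) (half_trace_top hU)
  (half_trace_top hW) (half_trace_top hV)).
rewrite (pairing_linl (Lam_gt0 hP) c (TplusPML_order_one hP) (half_trace_top hU)
  (half_trace_top hW) (half_trace_top hV)).
exact: regroup.
Qed.

Lemma boundary_defect_linr (c : R[i]) U V W : HH P U -> HH P V -> HH P W ->
  boundary_defect U (c *: V + W) =
  c^*%C * boundary_defect U V + boundary_defect U W.
Proof.
move=> hU hV hW; rewrite /boundary_defect Tminus_linr//.
rewrite (TminusPML_linr hP hlayer c hU.2 hV.2 hW.2) !TplusPML_pairE !Tplus_pairE.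
rewrite (pairing_linr (Lam_gt0 hP) c (Tplus_order_one hP) (half_trace_top hU)
  (half_trace_top hV) (half_trace_top hW)).
rewrite (pairing_linr (Lam_gt0 hP) c (TplusPML_order_one hP) (half_trace_top hU)
  (half_trace_top hV) (half_trace_top hW)).
exact: regroup.
Qed.

End BoundaryForms.

(** * Perturbation of an inf-sup stable problem *)

Section GeometricSequences.
Context {R : realType}.

Lemma geometric_limit (y : nat -> R) (C q : R) : 0 <= q < 1 ->
  (forall n, `|y n.+1 - y n| <= C * q ^+ n) ->
  exists l, forall n, `|l - y n| <= C / (1 - q) * q ^+ n.
Proof.
move=> /andP[q0 q1] yC; have q1' : 1 - q != 0 by rewrite gt_eqF// subr_gt0.
pose r n := C / (1 - q) * q ^+ n.
have rS n : r n - r n.+1 = C * q ^+ n by rewrite /r exprS; field.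
have C0 : 0 <= C by have := yC 0; rewrite expr0 mulr1; exact: le_trans.
have r0 n : 0 <= r n by rewrite !mulr_ge0 ?exprn_ge0// invr_ge0 subr_ge0 ltW.
(* [y - r] increases, [y + r] decreases, and the limit lies between them. *)
have lo n k : y n - r n <= y (n + k)%N - r (n + k)%N.
  elim: k => [|k ih]; first by rewrite addn0.
  rewrite addnS (le_trans ih)//.
  by have := rS (n + k)%N; have := yC (n + k)%N; rewrite ler_norml => /andP[? ?] ?; lra.
have hi n k : y (n + k)%N + r (n + k)%N <= y n + r n.
  elim: k => [|k ih]; first by rewrite addn0.
  rewrite addnS (le_trans _ ih)//.
  by have := rS (n + k)%N; have := yC (n + k)%N; rewrite ler_norml => /andP[? ?] ?; lra.
have lohi n m : y n - r n <= y m + r m.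
  have := lo n m; have := hi m n; rewrite addnC; have := r0 (n + m)%N; lra.
pose Z := range (fun n => y n - r n).
have ubZ m : ubound Z (y m + r m) by move=> _ [n _ <-]; exact: lohi.
have Z0 : Z !=set0 by exists (y 0 - r 0), 0.
exists (sup Z) => n; rewrite ler_distl; apply/andP; split.
  by apply: ub_le_sup; [exists (y 0 + r 0); exact: ubZ|exists n].
exact: ge_sup (ubZ n).
Qed.

Lemma complex_geometric_limit (y : nat -> R[i]) (C q : R) : 0 <= q < 1 ->
  (forall n, cabs (y n.+1 - y n) <= C * q ^+ n) ->
  exists l, forall n, cabs (l - y n) <= 2 * (C / (1 - q)) * q ^+ n.
Proof.
move=> q01 yC.
have reC n : `|complex.Re (y n.+1) - complex.Re (y n)| <= C * q ^+ n.
  by rewrite -raddfB (le_trans (ler_Re_cabs _)).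
have imC n : `|complex.Im (y n.+1) - complex.Im (y n)| <= C * q ^+ n.
  by rewrite -raddfB (le_trans (ler_Im_cabs _)).
have [a aR] := @geometric_limit (fun n => complex.Re (y n)) C q q01 reC.
have [b bI] := @geometric_limit (fun n => complex.Im (y n)) C q q01 imC.
exists (a +i* b)%C => n; rewrite (le_trans (cabs_le_ReIm _))// -mulrA mulr2n mulrDl mul1r.
by move: (aR n) (bI n); case: (y n) => c d /= ? ?; rewrite lerD.
Qed.

Lemma geometric_bound_le0 (x C q : R) : 0 <= q < 1 ->
  (forall n, x <= C * q ^+ n) -> x <= 0.
Proof.
move=> /andP[q0 q1] xC.
have cq : (fun n => C * q ^+ n) @ \oo --> (0 : R).
  rewrite -[X in _ --> X](mulr0 C); apply: cvgM; first exact: cvg_cst.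
  by apply: cvg_expr; rewrite ger0_norm.
by apply: (cvgr_to_ge cq); apply: nearW.
Qed.

End GeometricSequences.

(** The form [a] satisfies an inf-sup condition with constant [gamma] and represents
  every bounded antilinear functional; [d] is a sesquilinear perturbation of norm
  [K < gamma]. The Picard iteration [a w_{n+1} = d (u + w_n)] contracts with ratio
  [K / gamma]. Instead of a limit of the [w_n], one takes the limit of the
  functionals [d (u + w_n)], which converge pointwise in the complex numbers; the
  limit [m] is again bounded and antilinear, hence [m = a w] for some [w], and the
  inf-sup condition forces [N (w - w_n)] to zero, whence [m = d (u + w)]. So the
  only completeness involved is that of the complex numbers. *)
Lemma perturbed_solvability (R : realType) (V : lmodType R[i]) (H : V -> Prop)
  (N : V -> R) (a d : V -> V -> R[i]) (gamma K : R) :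
  (forall (c : R[i]) u w, H u -> H w -> H (c *: u + w)) ->
  (forall v, 0 <= N v) ->
  (forall (c : R[i]) u w v, H u -> H w -> H v ->
     a (c *: u + w) v = c * a u v + a w v) ->
  (forall (c : R[i]) u w v, H u -> H w -> H v ->
     d (c *: u + w) v = c * d u v + d w v) ->
  (forall (c : R[i]) u v w, H u -> H v -> H w ->
     d u (c *: v + w) = c^*%C * d u v + d u w) ->
  (forall u v, H u -> H v -> cabs (d u v) <= K * N u * N v) ->
  (forall w M, H w -> 0 <= M -> (forall v, H v -> cabs (a w v) <= M * N v) ->
     gamma * N w <= M) ->
  (forall l : V -> R[i],
     (forall (c : R[i]) v w, H v -> H w -> l (c *: v + w) = c^*%C * l v + l w) ->
     (exists M, forall v, H v -> cabs (l v) <= M * N v) ->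
     exists2 w, H w & forall v, H v -> a w v = l v) ->
  0 <= K -> K < gamma ->
  forall u, H u -> exists2 w, H w & forall v, H v -> a w v = d (u + w) v.
Proof.
move=> Hlin N0 a_lin d_linl d_linr d_bound coercive solvable K0 Kg u Hu.
have g0 : 0 < gamma := le_lt_trans K0 Kg.
pose q := K / gamma.
have q01 : 0 <= q < 1 by rewrite divr_ge0 ?(ltW g0)//= ltr_pdivrMr// mul1r.
have H0 : H 0 by have := Hlin (-1) _ _ Hu Hu; rewrite scaleN1r addNr.
have HD v w : H v -> H w -> H (v + w).
  by move=> hv hw; have := Hlin 1 _ _ hv hw; rewrite scale1r.
have HB v w : H v -> H w -> H (v - w).
  by move=> hv hw; have := Hlin (-1) _ _ hw hv; rewrite scaleN1r addrC.
have aB v w z : H v -> H w -> H z -> a (v - w) z = a v z - a w z.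
  move=> hv hw hz; have := a_lin (-1) _ _ _ hw hv hz.
  by rewrite scaleN1r addrC mulN1r => ->; rewrite addrC.
have dB v w z : H v -> H w -> H z -> d (v - w) z = d v z - d w z.
  move=> hv hw hz; have := d_linl (-1) _ _ _ hw hv hz.
  by rewrite scaleN1r addrC mulN1r => ->; rewrite addrC.
have [s sP] : {s : V -> V & forall w, H w -> H (s w) /\
    forall v, H v -> a (s w) v = d (u + w) v}.
  apply: (@choice _ _ (fun w w' => H w -> H w' /\
    forall v, H v -> a w' v = d (u + w) v)) => w.
  have [hw|nw] := pselect (H w); last by exists 0.
  have [] := solvable (d (u + w)).
  - by move=> c v z hv hz; apply: d_linr => //; exact: HD.
  - by exists (K * N (u + w)) => v hv; apply: d_bound => //; exact: HD.
  by move=> w' hw' e; exists w'.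
pose W n := iter n s 0.
have HW n : H (W n) by elim: n => [//|n ih]; exact: (sP _ ih).1.
have aW n v : H v -> a (W n.+1) v = d (u + W n) v by exact: (sP _ (HW n)).2.
have HuW n : H (u + W n) by exact: HD.
pose e0 := N (W 1 - W 0).
have step n : N (W n.+1 - W n) <= e0 * q ^+ n.
  elim: n => [|n ih]; first by rewrite expr0 mulr1.
  rewrite exprS mulrCA (le_trans _ (ler_wpM2l (andP q01).1 ih))//.
  rewrite /q mulrAC ler_pdivlMr// mulrC; apply: coercive; first exact: HB.
    by rewrite mulr_ge0.
  move=> v hv; rewrite aB// !aW// -dB// opprD addrACA subrr add0r.
  by apply: d_bound => //; exact: HB.
have [m mP] : {m : V -> R[i] & forall v, H v -> forall n,
    cabs (m v - d (u + W n) v) <= 2 * (K * e0 * N v / (1 - q)) * q ^+ n}.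
  apply: (@choice _ _ (fun v z => H v -> forall n,
    cabs (z - d (u + W n) v) <= 2 * (K * e0 * N v / (1 - q)) * q ^+ n)) => v.
  have [hv|nv] := pselect (H v); last by exists 0.
  have near n : cabs (d (u + W n.+1) v - d (u + W n) v) <= K * e0 * N v * q ^+ n.
    rewrite -dB// opprD addrACA subrr add0r.
    rewrite (le_trans (d_bound _ _ (HB _ _ (HW _) (HW _)) hv))//.
    rewrite [leRHS]mulrAC ler_wpM2r//.
    by rewrite -mulrA ler_wpM2l.
  have [l lP] := @complex_geometric_limit R (fun n => d (u + W n) v) _ q q01 near.
  by exists l.
pose C := 2 * (K * e0 / (1 - q)).
have C0 : 0 <= C.
  by rewrite !mulr_ge0// ?invr_ge0 ?subr_ge0 ?(ltW (andP q01).2)// N0.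
have mC v n : H v -> cabs (m v - d (u + W n) v) <= C * q ^+ n * N v.
  move=> hv; rewrite (le_trans (mP v hv n))// le_eqVlt; apply/orP; left; apply/eqP.
  by rewrite /C; ring.
have qn0 n : 0 <= q ^+ n by rewrite exprn_ge0//; case/andP: q01.
have m_lin (c : R[i]) v w : H v -> H w -> m (c *: v + w) = c^*%C * m v + m w.
  move=> hv hw; apply/eqP; rewrite -subr_eq0; apply/eqP; apply: cabs_eq0.
  apply/eqP; rewrite eq_le cabs_ge0 andbT.
  pose C' := C * (N (c *: v + w) + cabs c * N v + N w).
  apply: (@geometric_bound_le0 _ _ C' q q01) => n.
  have -> : m (c *: v + w) - (c^*%C * m v + m w) =
      (m (c *: v + w) - d (u + W n) (c *: v + w)) +
      - (c^*%C * (m v - d (u + W n) v) + (m w - d (u + W n) w)).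
    by rewrite d_linr//; ring.
  rewrite (le_trans (cabsD _ _))// cabsN.
  have t1 := mC _ n (Hlin c _ _ hv hw).
  have t2 := cabsD (c^*%C * (m v - d (u + W n) v)) (m w - d (u + W n) w).
  rewrite cabsM cabsJ in t2.
  have t3 := ler_wpM2l (cabs_ge0 c) (mC _ n hv).
  have t4 := mC _ n hw.
  apply: (le_trans (lerD t1 (le_trans t2 (lerD t3 t4)))).
  by rewrite le_eqVlt /C'; apply/orP; left; apply/eqP; ring.
have m_bound : exists M, forall v, H v -> cabs (m v) <= M * N v.
  exists (C + K * N (u + W 0)) => v hv; rewrite -[m v](subrK (d (u + W 0) v)).
  rewrite (le_trans (cabsD _ _))// mulrDl lerD//; last exact: d_bound.
  by have := mC v 0 hv; rewrite expr0 mulr1.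
have [w hw aw] := solvable m m_lin m_bound.
exists w => // v hv; rewrite aw//; apply/eqP; rewrite -subr_eq0; apply/eqP.
have wW n : gamma * N (w - W n.+1) <= C * q ^+ n.
  apply: coercive; [exact: HB|by rewrite mulr_ge0|move=> z hz].
  by rewrite aB// aw// aW// mC.
apply: cabs_eq0; apply/eqP; rewrite eq_le cabs_ge0 andbT.
apply: (@geometric_bound_le0 _ _ (C * N v + K * (C / gamma) * N v) q q01) => n.
have -> : m v - d (u + w) v =
    (m v - d (u + W n.+1) v) + - d (w - W n.+1) v.
  have -> : w - W n.+1 = (u + w) - (u + W n.+1) by rewrite opprD addrACA subrr add0r.
  by rewrite dB//; [ring|exact: HD].
rewrite (le_trans (cabsD _ _))// cabsN mulrDl lerD//.
  apply: (le_trans (mC v n.+1 hv)); rewrite mulrAC; apply: ler_wpM2l.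
    exact: mulr_ge0.
  by rewrite exprS ler_piMl//; case/andP: q01 => _ /ltW.
rewrite (le_trans (d_bound _ _ (HB _ _ hw (HW _)) hv))//.
rewrite [leRHS]mulrAC ler_wpM2r// -mulrA ler_wpM2l//.
by rewrite mulrAC ler_pdivlMr// mulrC.
Qed.

(** * The defect of the boundary operators and the PML solution *)

Section MainEstimates.
Context {R : realType} (P : setting R).
Hypothesis hP : standing P.
Hypothesis htrace : trace_inequalities P.
Hypothesis hest : operator_estimates P.

Lemma trace_top_le V : HH P V -> l2norm P (top V.1) <= gamma1 P * normplus P V.1.
Proof.
by move=> hV; have [t1 t2 _ _] := htrace hV; rewrite -lee_fin (le_trans t1 t2).
Qed.

Lemma trace_bot_le V : HH P V ->
  vl2norm P (fun i => bot (V.2 i)) <= gamma1 P * normminus P V.2.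
Proof.
by move=> hV; have [_ _ t1 t2] := htrace hV; rewrite -lee_fin (le_trans t1 t2).
Qed.

Lemma normplus_le V : normplus P V.1 <= hnorm P V.
Proof.
by rewrite -[leLHS]ger0_norm ?sqrtr_ge0// -sqrtr_sqr ler_wsqrtr// lerDl sqr_ge0.
Qed.

Lemma normminus_le V : normminus P V.2 <= hnorm P V.
Proof.
by rewrite -[leLHS]ger0_norm ?sqrtr_ge0// -sqrtr_sqr ler_wsqrtr// lerDr sqr_ge0.
Qed.

Lemma cauchy_schwarz2 (x y z w : R) : x * y + z * w <=
  Num.sqrt (x ^+ 2 + z ^+ 2) * Num.sqrt (y ^+ 2 + w ^+ 2).
Proof.
rewrite -sqrtrM ?addr_ge0 ?sqr_ge0// (le_trans (ler_norm _))// -sqrtr_sqr.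
by rewrite ler_wsqrtr//; have := sqr_ge0 (x * w - z * y); rewrite !expr2; nra.
Qed.

Lemma boundary_defect_le_traces U V : HH P U -> HH P V ->
  cabs (boundary_defect P U V) <=
  (F1 P * gamma1 P * l2norm P (top U.1) +
   F2 P * gamma1 P * vl2norm P (fun i => bot (U.2 i))) * hnorm P V.
Proof.
move=> hU hV; have [e1 e2] := hest hU hV.
have g0 : 0 <= gamma1 P := sqrtr_ge0 _.
have bound (f x y n : R) : 0 <= f -> 0 <= x -> y <= gamma1 P * n ->
    f * x * y <= f * gamma1 P * x * n.
  move=> f0 x0 yn; have -> : f * gamma1 P * x * n = f * x * (gamma1 P * n) by ring.
  by rewrite ler_wpM2l// mulr_ge0.
rewrite /boundary_defect (le_trans (cabsD _ _))// mulrDl lerD//.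
  apply: (le_trans e1); apply: bound; rewrite ?F1_ge0 ?sqrtr_ge0//.
  by rewrite (le_trans (trace_top_le hV))// ler_wpM2l// normplus_le.
apply: (le_trans e2); apply: bound; rewrite ?F2_ge0 ?sqrtr_ge0//.
by rewrite (le_trans (trace_bot_le hV))// ler_wpM2l// normminus_le.
Qed.

Lemma boundary_defect_le U V : HH P U -> HH P V ->
  cabs (boundary_defect P U V) <=
  Num.max (F1 P) (F2 P) * gamma1 P ^+ 2 * hnorm P U * hnorm P V.
Proof.
move=> hU hV; have [e1 e2] := hest hU hV.
have g0 : 0 <= gamma1 P := sqrtr_ge0 _.
set F := Num.max _ _.
have F1F : F1 P <= F by rewrite le_max lexx.
have F2F : F2 P <= F by rewrite le_max lexx orbT.
have F0 : 0 <= F by rewrite (le_trans (F1_ge0 hP)).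
pose B := F * gamma1 P ^+ 2.
have bound (f x y nx ny : R) : 0 <= f <= F -> 0 <= x <= gamma1 P * nx ->
    0 <= y <= gamma1 P * ny -> f * x * y <= B * (nx * ny).
  move=> /andP[f0 fF] /andP[x0 xn] /andP[y0 yn].
  have -> : B * (nx * ny) = F * (gamma1 P * nx) * (gamma1 P * ny) by rewrite /B; ring.
  by rewrite ler_pM ?mulr_ge0// ler_pM.
rewrite /boundary_defect (le_trans (cabsD _ _))//.
apply: (@le_trans _ _ (B * (normplus P U.1 * normplus P V.1) +
    B * (normminus P U.2 * normminus P V.2))).
  apply: lerD; [apply: (le_trans e1)|apply: (le_trans e2)]; apply: bound.
  - by rewrite F1_ge0.
  - by rewrite sqrtr_ge0 trace_top_le.
  - by rewrite sqrtr_ge0 trace_top_le.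
  - by rewrite F2_ge0.
  - by rewrite sqrtr_ge0 trace_bot_le.
  - by rewrite sqrtr_ge0 trace_bot_le.
rewrite -mulrDr -mulrA ler_wpM2l ?mulr_ge0 ?sqr_ge0//.
exact: cauchy_schwarz2.
Qed.

Lemma dual_norm_le (l : hsob R -> R[i]) (M : R) :
  (forall V, HH P V -> cabs (l V) <= M * hnorm P V) ->
  (dual_norm P l <= M%:E)%E.
Proof.
move=> lM; apply: ge_ereal_sup => _ [V [hV nV] <-].
have V0 : 0 < hnorm P V.
  rewrite lt_neqAle sqrtr_ge0 andbT eq_sym; apply/eqP => e; apply: nV.
  by rewrite /heq subr0.
by rewrite lee_fin ler_pdivrMr// lM.
Qed.

End MainEstimates.

Theorem theorem1 (R : realType) (P : setting R) (gamma0 : R) (U : hsob R)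
  (hP : standing P)
  (hlayer : layer_uniquely_solvable P)
  (hA : forall l, bounded_antilinear P l -> has_unique_solution P (A P) l)
  (hgamma0 : 0 < gamma0)
  (hinfsup : forall W, HH P W ->
     ((gamma0 * hnorm P W)%:E <= dual_norm P (A P W))%E)
  (htrace : trace_inequalities P)
  (hest : operator_estimates P)
  (hU : solves P (A P) (Lrhs P) U)
  (hF : Num.max (F1 P) (F2 P) * gamma1 P ^+ 2 < gamma0) :
  exists Upml : hsob R,
    [/\ solves P (APML P) (Lrhs P) Upml,
        forall U', solves P (APML P) (Lrhs P) U' -> heq P U' Upml &
        (dual_norm P (A P (U - Upml)%R) <=
          (F1 P * gamma1 P * l2norm P (top Upml.1) +
           F2 P * gamma1 P * vl2norm P (fun i => bot (Upml.2 i)))%:E)%E].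
Proof.
have [HU AU] := hU.
set K := _ * gamma1 P ^+ 2 in hF.
have K0 : 0 <= K by rewrite mulr_ge0 ?sqr_ge0// le_max F1_ge0.
have HB V W : HH P V -> HH P W -> HH P (V - W).
  by move=> hV hW; have := HH_lin hP (-1) hW hV; rewrite scaleN1r addrC.
have AB V W Z : HH P V -> HH P W -> HH P Z -> A P (V - W) Z = A P V Z - A P W Z.
  move=> hV hW hZ; have := A_linl hP htrace (-1) hW hV hZ.
  by rewrite scaleN1r addrC mulN1r => ->; rewrite addrC.
have dB V W Z : HH P V -> HH P W -> HH P Z ->
    boundary_defect P (V - W) Z = boundary_defect P V Z - boundary_defect P W Z.
  move=> hV hW hZ; have := boundary_defect_linl hP htrace hlayer (-1) hW hV hZ.
  by rewrite scaleN1r addrC mulN1r => ->; rewrite addrC.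
have coercive W M : HH P W ->
    (forall V, HH P V -> cabs (A P W V) <= M * hnorm P V) -> gamma0 * hnorm P W <= M.
  by move=> hW b; rewrite -lee_fin (le_trans (hinfsup _ hW))// dual_norm_le.
(* The sum [U + W] solves the PML problem iff [A(W, V) = d(U + W, V)];
   unlike [L], the right-hand side is visibly bounded in the norm of [V]. *)
have [W hW AW] : exists2 W, HH P W &
    forall V, HH P V -> A P W V = boundary_defect P (U + W) V.
  apply: (@perturbed_solvability R (hsob R) (HH P) (hnorm P) (A P)
    (boundary_defect P) gamma0 K).
  - exact: HH_lin.
  - by move=> V; exact: sqrtr_ge0.
  - exact: A_linl.
  - exact: boundary_defect_linl.
  - exact: boundary_defect_linr.
  - exact: boundary_defect_le.
  - by move=> Z M hZ _; exact: coercive.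
  - by move=> l l1 l2; have [Z [[hZ eZ] _]] := hA l (conj l1 l2); exists Z.
  - exact: K0.
  - exact: hF.
  - exact: HU.
have hUp : HH P (U + W) by have := HH_lin hP 1 HU hW; rewrite scale1r.
have AUp V : HH P V -> A P (U + W) V = Lrhs P V + boundary_defect P (U + W) V.
  move=> hV; have := A_linl hP htrace 1 HU hW hV.
  by rewrite scale1r mul1r AU// AW.
have Upml_solves : solves P (APML P) (Lrhs P) (U + W).
  by split=> // V hV; rewrite APML_defect AUp// addrK.
exists (U + W); split => //.
- move=> U' [hU' eU']; have hd := HB _ _ hU' hUp.
  have le : gamma0 * hnorm P (U' - (U + W)) <= K * hnorm P (U' - (U + W)).
    apply: coercive => // V hV.
    rewrite (_ : A P _ V = boundary_defect P (U' - (U + W)) V).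
      exact: boundary_defect_le.
    have := eU' V hV; rewrite APML_defect => /eqP; rewrite subr_eq => /eqP e.
    by rewrite AB// dB// e AUp// opprD addrACA subrr add0r.
  apply/eqP; rewrite /heq eq_le sqrtr_ge0 andbT.
  rewrite -(pmulr_rle0 _ (_ : 0 < gamma0 - K)) ?subr_gt0//.
  by rewrite mulrBl subr_le0.
- apply: dual_norm_le => V hV; rewrite AB// AU// AUp// opprD addNKr cabsN.
  exact: boundary_defect_le_traces.
Qed.
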